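(* Let $A=A_1+\cdots+A_\tau\in\mathbb{C}^{n\times n}$ be a Hermitian matrix where each $A_\ell\in\mathbb{C}^{n\times n}$ is Hermitian with $\|A_\ell\|\le 1$ and $\mathrm{rank}(A_\ell)\le r$ for all $\ell\in[\tau]$, and suppose sampling and query access to each $A_\ell$ is given. Run the procedure described in the context with error parameter $\epsilon>0$, obtaining $S$, singular values $\sigma_1,\dots,\sigma_{\tilde r}$ and singular vectors $u_1,\dots,u_{\tilde r}\in\mathbb{C}^p$, and let $V\in\mathbb{C}^{n\times\tilde r}$ be the matrix with columns $V(\cdot,j)=\frac{S^\dagger u_j}{\sigma_j}$, $j\in[\tilde r]$. Then with probability at least $9/10$, $$\|VV^\dagger AVV^\dagger-A\|_F\le\frac{\epsilon}{300r^2}\Big(2+\frac{\epsilon}{300r^2(\tau+1)}\Big).$$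
   Context: Sampling and query access to $M\in\mathbb{C}^{n\times n}$: one can sample row $i$ with probability $\|M(i,\cdot)\|^2/\|M\|_F^2$, sample $j$ given $i$ with probability $|M(i,j)|^2/\|M(i,\cdot)\|^2$, query entries, and evaluate $\|M\|_F$ and row norms. The procedure (weighted sampling and singular vector approximation) with input $A_1,\dots,A_\tau$ and $\epsilon$: set $p=2\cdot 10^{20}\tau^{12}r^{19}/\epsilon^6$ and $\gamma=\epsilon^2/(3\times 10^6\tau^2r^6)$. Sample $i_1,\dots,i_p$ i.i.d. from $[n]$ with $P_i=\sum_{\ell=1}^\tau\|A_\ell(i,\cdot)\|^2/\sum_{\ell=1}^\tau\|A_\ell\|_F^2$. Let $S_\ell\in\mathbb{C}^{p\times n}$ have rows $S_\ell(t,\cdot)=A_\ell(i_t,\cdot)/\sqrt{pP_{i_t}}$ and $S=\sum_\ell S_\ell$. Then $p$ times independently: pick $t\in[p]$ uniformly and sample $j\in[n]$ with probability $Q_{j|i_t}=\sum_{k=1}^\tau|A_k(i_t,j)|^2/\sum_{\ell=1}^\tau\|A_\ell(i_t,\cdot)\|^2$, giving $j_1,\dots,j_p$. Let $P'_j=\frac1p\sum_{t=1}^pQ_{j|i_t}$, $W_\ell\in\mathbb{C}^{p\times p}$ with columns $W_\ell(\cdot,t)=S_\ell(\cdot,j_t)/\sqrt{pP'_{j_t}}$, and $W=\sum_\ell W_\ell$. With $\hat r=\mathrm{rank}(A)$, compute the top $\hat r$ singular values $\sigma_1,\dots,\sigma_{\hat r}$ of $W$ with corresponding (orthonormal) left singular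 vectors $u_1,\dots,u_{\hat r}$, discard those with $\sigma_j^2<\gamma\sum_{\ell=1}^\tau\|W_\ell\|_F^2$, and let $\tilde r$ be the number remaining (reindexed $\sigma_1,\dots,\sigma_{\tilde r}$, $u_1,\dots,u_{\tilde r}$). $\|\cdot\|$ is the spectral norm, $\|\cdot\|_F$ the Frobenius norm, $\dagger$ the conjugate transpose. *)

(* Defs.v *)
From HB Require Import structures.
From mathcomp Require Import all_boot all_order all_algebra.
From mathcomp Require Import complex.
From mathcomp Require Import all_classical all_reals all_analysis.

Set Implicit Arguments.
Unset Strict Implicit.
Unset Printing Implicit Defensive.

Import Order.TTheory GRing.Theory Num.Theory.

Local Open Scope classical_set_scope.
Local Open Scope ring_scope.
Local Open Scope complex_scope.
Local Open Scope sesquilinear_scope.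

Definition abs2 (R : realType) (z : R[i]) : R := ComplexField.Normc.normc z ^+ 2.

Definition row_norm2 (R : realType) (m n : nat) (M : 'M[R[i]]_(m, n)) (i : 'I_m)
    : R :=
  \sum_j abs2 (M i j).

Definition fro_norm2 (R : realType) (m n : nat) (M : 'M[R[i]]_(m, n)) : R :=
  \sum_i row_norm2 M i.

Definition fro_norm (R : realType) (m n : nat) (M : 'M[R[i]]_(m, n)) : R :=
  Num.sqrt (fro_norm2 M).

(* On a column vector, [fro_norm] is the Euclidean norm. *)
Definition spectral_norm (R : realType) (m n : nat) (M : 'M[R[i]]_(m, n)) : R :=
  sup [set fro_norm (M *m x) | x in [set x : 'cV[R[i]]_n | fro_norm x <= 1]].

(* The singular values are listed in nonincreasing order, so that
   s 0 0, ..., s 0 (k - 1) are the top k of them; the j-th column of U is a left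
   singular vector for s 0 j. *)
Definition is_svd (R : realType) (p : nat) (W : 'M[R[i]]_p) (s : 'rV[R]_p)
    (U : 'M[R[i]]_p) : Prop :=
  [/\ forall j, 0 <= s 0 j,
      forall j k : 'I_p, (j <= k)%N -> s 0 k <= s 0 j,
      U \is unitarymx &
      exists2 Z : 'M[R[i]]_p, Z \is unitarymx &
        W = U *m diag_mx (map_mx (real_complex R) s) *m Z ^t*].

(* The number p of samples has to be an integer: its real value is rounded up. *)
Definition num_samples (R : realType) (tau r : nat) (eps : R) : nat :=
  `|Num.ceil (2 * 10 ^+ 20 * tau%:R ^+ 12 * r%:R ^+ 19 / eps ^+ 6 : R)|%N.

Definition threshold (R : realType) (tau r : nat) (eps : R) : R :=
  eps ^+ 2 / (3 * 10 ^+ 6 * tau%:R ^+ 2 * r%:R ^+ 6).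

Definition rowP (R : realType) (tau n : nat) (A : 'I_tau -> 'M[R[i]]_n)
    (i : 'I_n) : R :=
  (\sum_l row_norm2 (A l) i) / (\sum_l fro_norm2 (A l)).

Definition colQ (R : realType) (tau n : nat) (A : 'I_tau -> 'M[R[i]]_n)
    (i j : 'I_n) : R :=
  (\sum_k abs2 (A k i j)) / (\sum_l row_norm2 (A l) i).

Definition colP (R : realType) (tau n p : nat) (A : 'I_tau -> 'M[R[i]]_n)
    (i : {ffun 'I_p -> 'I_n}) (j : 'I_n) : R :=
  p%:R^-1 * \sum_t colQ A (i t) j.

Definition sampleS (R : realType) (tau n p : nat) (A : 'I_tau -> 'M[R[i]]_n)
    (i : {ffun 'I_p -> 'I_n}) (l : 'I_tau) : 'M[R[i]]_(p, n) :=
  \matrix_(t, k) (A l (i t) k / (Num.sqrt (p%:R * rowP A (i t)))%:C).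

Definition sampleW (R : realType) (tau n p : nat) (A : 'I_tau -> 'M[R[i]]_n)
    (i j : {ffun 'I_p -> 'I_n}) (l : 'I_tau) : 'M[R[i]]_p :=
  \matrix_(s, t)
    (sampleS A i l s (j t) / (Num.sqrt (p%:R * colP A i (j t)))%:C).

(* Joint law of the random choices of one run: the row indices i_s are i.i.d.
   with law rowP; given them, the pairs (t_s, j_s) are i.i.d., with t_s uniform
   on 'I_p and j_s of law colQ A i_(t_s). When all the A l vanish, rowP is
   identically 0 and, unless p = 0, no such run exists. *)
Definition sampling_run (R : realType) (d : measure_display)
    (Omega : measurableType d) (Pr : probability Omega R) (tau n p : nat)
    (A : 'I_tau -> 'M[R[i]]_n) (i : Omega -> {ffun 'I_p -> 'I_n})
    (t : Omega -> {ffun 'I_p -> 'I_p}) (j : Omega -> {ffun 'I_p -> 'I_n})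
    : Prop :=
  forall (i0 : {ffun 'I_p -> 'I_n}) (t0 : {ffun 'I_p -> 'I_p})
         (j0 : {ffun 'I_p -> 'I_n}),
    let E := [set w | [/\ i w = i0, t w = t0 & j w = j0]] in
    measurable E /\
    Pr E = ((\prod_s rowP A (i0 s)) *
            \prod_s (p%:R^-1 * colQ A (i0 (t0 s)) (j0 s)))%:E.

(* Positions, among the top rhat singular values s of W, of the ones that are
   not discarded. *)
Definition kept (R : realType) (tau p : nat) (rhat : nat) (gamma : R)
    (Wl : 'I_tau -> 'M[R[i]]_p) (s : 'rV[R]_p) : pred 'I_p :=
  [pred j : 'I_p | (j < rhat)%N &&
     ~~ (s 0 j ^+ 2 < gamma * \sum_l fro_norm2 (Wl l))].

(* [enum_val] lists the elements of K in increasing order, so the retained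
   singular values keep their order when they are reindexed by 'I_#|K|. *)
Definition approxV (R : realType) (n p : nat) (S : 'M[R[i]]_(p, n))
    (s : 'rV[R]_p) (U : 'M[R[i]]_p) (K : pred 'I_p) : 'M[R[i]]_(n, #|K|) :=
  \matrix_(k, j)
    ((S ^t* *m col (enum_val j) U) k 0 / (s 0 (enum_val j))%:C).

(* Main.v *)
Require Import Defs.
From HB Require Import structures.
From mathcomp Require Import all_boot all_order all_algebra.
From mathcomp Require Import complex ring lra.
From mathcomp Require Import all_classical all_reals all_analysis.

(* Put Phi = sum_l |A_l|_F^2. Both sampling steps are importance samplings, so
   S^H S and W W^H are unbiased estimators of A^H A and S S^H, and the sampling
   densities dominate the squared row norms of A and of S^H up to a factor
   tau Phi. Hence both Gram errors have second moment at most (tau Phi)^2 / p,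
   and Markov's inequality bounds them by some theta outside an event of
   probability 1/10. Moreover sum_l |W_l|_F^2 = Phi almost surely, so that
   g = gamma Phi is the actual cutoff on the squared singular values of W.

   The rest is deterministic. With P = V V^H and delta = theta / g one has
   |V^H V - 1|_F <= delta, so |P A P - A|_F <= (2 + delta) |(1 - P) A|_F. Let
   U_K be the matrix of the retained left singular vectors. Then S (1 - P) is
   close to (1 - U_K U_K^H) S, whose squared norm is at most
   2 sqrt(rank A) theta + (rank A) g by the Ky Fan inequality for W W^H.
   Finally A^H A - S^H S is supported on the row space of A, so passing from S
   to A costs only sqrt(rank A) theta.

   For large eps the quantity delta may exceed 1; then the crude bound
   |(1 - P) A|_F <= max(1, delta) |A|_F is already good enough. *)

Import Order.TTheory GRing.Theory Num.Theory.

Local Open Scope classical_set_scope.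
Local Open Scope ring_scope.
Local Open Scope complex_scope.
Local Open Scope sesquilinear_scope.

Set Implicit Arguments.
Unset Strict Implicit.

(** * Frobenius inner product *)

Section FrobeniusProduct.
Variable R : realType.
Local Notation C := R[i].
Local Notation Re := (@complex.Re R).

Lemma abs2E (z : C) : abs2 z = Re (z * conjc z).
Proof.
case: z => a b; rewrite /abs2 /= sqr_sqrtr ?addr_ge0 ?sqr_ge0 //; ring.
Qed.

Lemma abs2_ge0 (z : C) : 0 <= abs2 z.
Proof. exact: sqr_ge0. Qed.

Lemma abs2_eq0 (z : C) : abs2 z = 0 -> z = 0.
Proof. by move/eqP; rewrite sqrf_eq0 => /eqP/ComplexField.Normc.eq0_normc. Qed.

Lemma abs2M (x y : C) : abs2 (x * y) = abs2 x * abs2 y.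
Proof. by rewrite /abs2 ComplexField.Normc.normcM exprMn. Qed.

Lemma abs2V (x : C) : abs2 (x^-1) = (abs2 x)^-1.
Proof. by rewrite /abs2 ComplexField.Normc.normcV exprVn. Qed.

Lemma abs2_real (x : R) : abs2 x%:C = x ^+ 2.
Proof. by rewrite abs2E /=; ring. Qed.

Lemma abs2_conj (z : C) : abs2 (conjc z) = abs2 z.
Proof. by case: z => a b; rewrite /abs2 /= sqrrN. Qed.

(** Taking the real part of the Hilbert-Schmidt product gives a symmetric real bilinear form with
    the same norm. *)
Definition ip m n (M N : 'M[C]_(m, n)) : R := Re (\tr (M *m N ^t*)).

Lemma ctrmxM m n k (M : 'M[C]_(m, n)) (N : 'M[C]_(n, k)) :
  (M *m N) ^t* = N ^t* *m M ^t*.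
Proof. by rewrite trmx_mul map_mxM. Qed.

Lemma ctrmxB m n (M N : 'M[C]_(m, n)) : (M - N) ^t* = M ^t* - N ^t*.
Proof. by rewrite linearB /= map_mxB. Qed.

Lemma ctrmx1 n : (1%:M : 'M[C]_n) ^t* = 1%:M.
Proof. by rewrite trmx1 map_mx1. Qed.

Lemma ReD (x y : C) : Re (x + y) = Re x + Re y.
Proof. by case: x => ? ?; case: y. Qed.

Lemma ReN (x : C) : Re (- x) = - Re x.
Proof. by case: x. Qed.

Lemma Re_sum (I : finType) (F : I -> C) : Re (\sum_i F i) = \sum_i Re (F i).
Proof. exact: (big_morph _ ReD). Qed.

Lemma ipDl m n (M N P : 'M[C]_(m, n)) : ip (M + N) P = ip M P + ip N P.
Proof. by rewrite /ip mulmxDl linearD ReD. Qed.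

Lemma ipNl m n (M P : 'M[C]_(m, n)) : ip (- M) P = - ip M P.
Proof. by rewrite /ip mulNmx linearN ReN. Qed.

Lemma ipE m n (M N : 'M[C]_(m, n)) :
  ip M N = \sum_i \sum_j Re (M i j * conjc (N i j)).
Proof.
rewrite /ip /mxtrace Re_sum; apply: eq_bigr => i _; rewrite mxE Re_sum.
by apply: eq_bigr => j _; rewrite !mxE.
Qed.

Lemma ipC m n (M N : 'M[C]_(m, n)) : ip M N = ip N M.
Proof.
rewrite !ipE; apply: eq_bigr => i _; apply: eq_bigr => j _.
by case: (M i j) => a b; case: (N i j) => c d /=; ring.
Qed.

Lemma ipBl m n (M N P : 'M[C]_(m, n)) : ip (M - N) P = ip M P - ip N P.
Proof. by rewrite ipDl ipNl. Qed.

Lemma ipBr m n (M N P : 'M[C]_(m, n)) : ip P (M - N) = ip P M - ip P N.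
Proof. by rewrite ipC ipBl ipC (ipC N). Qed.

Lemma ipDr m n (M N P : 'M[C]_(m, n)) : ip P (M + N) = ip P M + ip P N.
Proof. by rewrite ipC ipDl ipC (ipC N). Qed.

Lemma ipZl m n (c : R) (M P : 'M[C]_(m, n)) : ip (c%:C *: M) P = c * ip M P.
Proof.
rewrite !ipE mulr_sumr; apply: eq_bigr => i _; rewrite mulr_sumr.
apply: eq_bigr => j _; rewrite mxE.
by case: (M i j) => a b; case: (P i j) => u v /=; ring.
Qed.

Lemma ip_mulmxl m n k (B : 'M[C]_(k, m)) (M : 'M[C]_(m, n)) (N : 'M[C]_(k, n)) :
  ip (B *m M) N = ip M (B ^t* *m N).
Proof. by rewrite /ip ctrmxM trmxCK -mulmxA mxtrace_mulC mulmxA. Qed.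

Lemma ip_mulmxr m n k (B : 'M[C]_(n, k)) (M : 'M[C]_(m, n)) (N : 'M[C]_(m, k)) :
  ip (M *m B) N = ip M (N *m B ^t*).
Proof. by rewrite /ip ctrmxM trmxCK mulmxA. Qed.

Lemma ip_adj m n (M N : 'M[C]_(m, n)) : ip (M ^t*) (N ^t*) = ip M N.
Proof. by rewrite [in RHS]ipC /ip trmxCK mxtrace_mulC. Qed.

Lemma fro_norm2E m n (M : 'M[C]_(m, n)) : fro_norm2 M = ip M M.
Proof.
rewrite ipE; apply: eq_bigr => i _; apply: eq_bigr => j _; exact: abs2E.
Qed.

Lemma row_norm2_ge0 m n (M : 'M[C]_(m, n)) i : 0 <= row_norm2 M i.
Proof. by apply: sumr_ge0 => j _; apply: abs2_ge0. Qed.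

Lemma fro_norm2_ge0 m n (M : 'M[C]_(m, n)) : 0 <= fro_norm2 M.
Proof. by apply: sumr_ge0 => i _; apply: row_norm2_ge0. Qed.

Lemma fro_norm_ge0 m n (M : 'M[C]_(m, n)) : 0 <= fro_norm M.
Proof. exact: sqrtr_ge0. Qed.

Lemma sqr_fro_norm m n (M : 'M[C]_(m, n)) : fro_norm M ^+ 2 = ip M M.
Proof. by rewrite sqr_sqrtr ?fro_norm2_ge0 // fro_norm2E. Qed.

Lemma fro_norm2_eq0 m n (M : 'M[C]_(m, n)) : fro_norm2 M = 0 -> M = 0.
Proof.
move/eqP; rewrite psumr_eq0; last by move=> *; apply: row_norm2_ge0.
move/allP => h; apply/matrixP => i j; rewrite mxE; apply: abs2_eq0.
have := h i (mem_index_enum _); rewrite psumr_eq0.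
  by move/allP/(_ j (mem_index_enum _))/eqP.
by move=> *; apply: abs2_ge0.
Qed.

Lemma ip0l m n (M : 'M[C]_(m, n)) : ip 0 M = 0.
Proof. by rewrite /ip mul0mx linear0. Qed.

Lemma fro_norm0 m n : fro_norm (0 : 'M[C]_(m, n)) = 0.
Proof. by rewrite /fro_norm fro_norm2E ip0l sqrtr0. Qed.

(** The squared norm of [c M - d N], with [c = ip N N] and [d = ip M N], expands to
    [c (c ip M M - d^2)]. *)
Lemma ip_cauchy_sqr m n (M N : 'M[C]_(m, n)) :
  ip M N ^+ 2 <= ip M M * ip N N.
Proof.
have [N0|N0] := eqVneq (ip N N) 0.
  have -> : N = 0 by apply: fro_norm2_eq0; rewrite fro_norm2E.
  by rewrite ipC !ip0l mulr0 expr0n.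
have Npos : 0 < ip N N by rewrite lt_def N0 -fro_norm2E fro_norm2_ge0.
set c := ip N N; set d := ip M N.
have := fro_norm2_ge0 (c%:C *: M - d%:C *: N).
rewrite fro_norm2E ipBl !ipBr !ipZl !(ipC _ (_ *: _)) !ipZl.
rewrite -/c (ipC N M) -/d => h.
have : 0 <= c * (ip M M * c - d ^+ 2).
  by apply: le_trans h _; rewrite le_eqVlt; apply/orP; left; apply/eqP; ring.
by rewrite pmulr_rge0 // subr_ge0.
Qed.

Lemma ip_cauchy m n (M N : 'M[C]_(m, n)) : `|ip M N| <= fro_norm M * fro_norm N.
Proof.
rewrite -(@ler_pXn2r _ 2) ?nnegrE ?mulr_ge0 ?fro_norm_ge0 //.
by rewrite real_normK ?num_real // exprMn !sqr_fro_norm ip_cauchy_sqr.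
Qed.

Lemma ler_ip m n (M N : 'M[C]_(m, n)) : ip M N <= fro_norm M * fro_norm N.
Proof. by apply: le_trans (ip_cauchy M N); apply: ler_norm. Qed.

Lemma fro_normN m n (M : 'M[C]_(m, n)) : fro_norm (- M) = fro_norm M.
Proof. by rewrite /fro_norm !fro_norm2E ipNl ipC ipNl opprK. Qed.

Lemma fro_norm_adj m n (M : 'M[C]_(m, n)) : fro_norm (M ^t*) = fro_norm M.
Proof. by rewrite /fro_norm !fro_norm2E ip_adj. Qed.

Lemma ler_fro_normD m n (M N : 'M[C]_(m, n)) :
  fro_norm (M + N) <= fro_norm M + fro_norm N.
Proof.
rewrite -(@ler_pXn2r _ 2) ?nnegrE ?addr_ge0 ?fro_norm_ge0 //.
rewrite sqr_fro_norm ipDl !ipDr (ipC N M) sqrrD !sqr_fro_norm.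
have := ler_ip M N; lra.
Qed.

End FrobeniusProduct.

(** * Near-isometries *)

Section NearIsometry.
Variable R : realType.
Local Notation C := R[i].

(** The real inequality gives the complex one by absorbing the phase: pairing [a] with
    [v_k = z conj b_k] yields exactly [|z|^2], and one factor [|z|^2] then cancels. *)
Lemma abs2_sum_mul n (a b : 'I_n -> C) :
  abs2 (\sum_k a k * b k) <= (\sum_k abs2 (a k)) * (\sum_k abs2 (b k)).
Proof.
pose z := \sum_k a k * b k; rewrite -/z.
have [z0|z0] := eqVneq (abs2 z) 0.
  by rewrite z0 mulr_ge0 // sumr_ge0 // => k _; apply: abs2_ge0.
have zpos : 0 < abs2 z by rewrite lt_def z0 abs2_ge0.
pose u : 'rV[C]_n := \row_k a k; pose v : 'rV[C]_n := \row_k (z * conjc (b k)).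
have ipuv : ip u v = abs2 z.
  rewrite ipE big_ord1 abs2E -Re_sum {2}/z mulr_suml; congr complex.Re.
  apply: eq_bigr => k _; rewrite !mxE rmorphM /=.
  by rewrite (conjcK (b k)) mulrAC mulrA.
have uu : ip u u = \sum_k abs2 (a k).
  rewrite ipE big_ord1; apply: eq_bigr => k _; rewrite !mxE; exact/esym/abs2E.
have vv : ip v v = abs2 z * \sum_k abs2 (b k).
  rewrite ipE big_ord1 mulr_sumr; apply: eq_bigr => k _.
  by rewrite !mxE -abs2E abs2M abs2_conj.
have := ip_cauchy_sqr u v.
by rewrite ipuv uu vv mulrCA expr2 ler_pM2l.
Qed.

Lemma fro_norm_mul m n k (M : 'M[C]_(m, n)) (N : 'M[C]_(n, k)) :
  fro_norm (M *m N) <= fro_norm M * fro_norm N.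
Proof.
rewrite -(@ler_pXn2r _ 2) ?nnegrE ?mulr_ge0 ?fro_norm_ge0 //.
rewrite exprMn !sqr_sqrtr ?fro_norm2_ge0 //.
rewrite mulr_suml; apply: ler_sum => i _.
have -> : fro_norm2 N = \sum_j \sum_l abs2 (N l j).
  by rewrite exchange_big.
rewrite mulr_sumr; apply: ler_sum => j _.
by rewrite mxE; apply: abs2_sum_mul.
Qed.

Variables (m n : nat) (V : 'M[C]_(m, n)) (d : R).
Hypothesis Vd : fro_norm (V ^t* *m V - 1%:M) <= d.

Lemma near_isometry_ge0 : 0 <= d.
Proof. by apply: le_trans Vd; apply: fro_norm_ge0. Qed.

Lemma near_isometry_sqr k (Y : 'M[C]_(n, k)) :
  ip (V *m Y) (V *m Y) <= (1 + d) * ip Y Y.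
Proof.
rewrite ip_mulmxl mulmxA -[_ *m V](subrK 1%:M) mulmxDl mul1mx ipDr.
have h := ler_ip Y ((V ^t* *m V - 1%:M) *m Y).
have h2 := fro_norm_mul (V ^t* *m V - 1%:M) Y.
have hY := fro_norm_ge0 Y.
rewrite mulrDl mul1r addrC lerD2l; apply: le_trans h _.
rewrite -sqr_fro_norm expr2 mulrCA; apply: ler_wpM2l => //.
by apply: le_trans h2 _; apply: ler_wpM2r.
Qed.

(** Since [|Y|^2 = <B, V Y>], Cauchy-Schwarz and the bound on [V Y] give
    [|Y|^4 <= (1 + d) |B|^2 |Y|^2], where [|Y|^2] cancels. *)
Lemma near_coisometry_sqr k (B : 'M[C]_(m, k)) :
  ip (V ^t* *m B) (V ^t* *m B) <= (1 + d) * ip B B.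
Proof.
have d0 := near_isometry_ge0.
set Y := V ^t* *m B.
have hY : ip Y Y = ip B (V *m Y) by rewrite {1}/Y ip_mulmxl trmxCK.
have h1 := ip_cauchy_sqr B (V *m Y); rewrite -hY in h1.
have h2 := near_isometry_sqr Y.
have YY : 0 <= ip Y Y by rewrite -fro_norm2E fro_norm2_ge0.
have BB : 0 <= ip B B by rewrite -fro_norm2E fro_norm2_ge0.
have h3 : ip Y Y ^+ 2 <= ip B B * ((1 + d) * ip Y Y).
  by apply: le_trans h1 _; apply: ler_wpM2l.
have [->|Y0] := eqVneq (ip Y Y) 0; first by rewrite mulr_ge0 ?addr_ge0.
have Ypos : 0 < ip Y Y by rewrite lt_def Y0.
by move: h3; rewrite expr2 mulrA ler_pM2r // mulrC.
Qed.

Lemma near_projector_norm k (B : 'M[C]_(m, k)) :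
  fro_norm (V *m V ^t* *m B) <= (1 + d) * fro_norm B.
Proof.
have d0 := near_isometry_ge0.
rewrite -(@ler_pXn2r _ 2) ?nnegrE ?mulr_ge0 ?fro_norm_ge0 ?addr_ge0 //.
rewrite exprMn !sqr_fro_norm -mulmxA.
apply: le_trans (near_isometry_sqr _) _.
by rewrite expr2 -mulrA ler_wpM2l ?addr_ge0 // near_coisometry_sqr.
Qed.

(** With [Y = V^H B] the squared norm is [|B|^2 - 2 |Y|^2 + |V Y|^2 <= |B|^2 + (d - 1) |Y|^2]. The
    last term is nonpositive for [d <= 1]; otherwise [|Y|^2 <= (1 + d) |B|^2] leads to
    [d^2 |B|^2]. *)
Lemma near_projector_compl_norm k (B : 'M[C]_(m, k)) :
  fro_norm ((1%:M - V *m V ^t*) *m B) <= Num.max 1 d * fro_norm B.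
Proof.
have d0 := near_isometry_ge0.
have BB : 0 <= ip B B by rewrite -fro_norm2E fro_norm2_ge0.
have M0 : 0 <= Num.max 1 d by rewrite le_max ler01.
rewrite -(@ler_pXn2r _ 2) ?nnegrE ?mulr_ge0 ?fro_norm_ge0 ?addr_ge0 //.
rewrite exprMn !sqr_fro_norm mulmxBl mul1mx -mulmxA.
set Y := V ^t* *m B.
have YY : 0 <= ip Y Y by rewrite -fro_norm2E fro_norm2_ge0.
have hY : ip B (V *m Y) = ip Y Y by rewrite {3}/Y ip_mulmxl trmxCK.
rewrite ipBl !ipBr hY (ipC (V *m Y) B) hY.
have h1 := near_isometry_sqr Y.
have h2 := near_coisometry_sqr B; rewrite -/Y in h2.
have [d1|d1] := leP d 1.
  rewrite expr1n mul1r.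
  have : d * ip Y Y <= ip Y Y by rewrite ler_piMl.
  lra.
have h4 : (d - 1) * ip Y Y <= (d - 1) * ((1 + d) * ip B B).
  by rewrite ler_wpM2l // subr_ge0 ltW.
lra.
Qed.

(** [A - P A P] splits as [P A (1 - P) + (1 - P) A]. As [A] and [P] are Hermitian, [A (1 - P)] is
    the adjoint of the second term, and [P] costs a factor [1 + d]. *)
Lemma near_projector_sandwich (A : 'M[C]_m) :
  A ^t* = A ->
  fro_norm (V *m V ^t* *m A *m V *m V ^t* - A) <=
  (2 + d) * fro_norm ((1%:M - V *m V ^t*) *m A).
Proof.
move=> hA; set P := V *m V ^t*.
have hP : P ^t* = P by rewrite /P ctrmxM trmxCK.
have hN : (1%:M - P) ^t* = 1%:M - P by rewrite ctrmxB ctrmx1 hP.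
have -> : P *m A *m V *m V ^t* - A =
   - (P *m (A *m (1%:M - P)) + (1%:M - P) *m A).
  rewrite -(mulmxA (P *m A)) -/P mulmxBr mulmx1 mulmxBl mul1mx mulmxBr.
  by rewrite !mulmxA [X in _ = - X]addrC addrA subrK opprB.
rewrite fro_normN; apply: le_trans (ler_fro_normD _ _) _.
have := near_projector_norm (A *m (1%:M - P)).
rewrite -/P -[fro_norm (A *m _)]fro_norm_adj ctrmxM hN hA; lra.
Qed.

End NearIsometry.

(** * Exact isometries and compression to the row space *)

Section Contraction.
Variable R : realType.
Local Notation C := R[i].

Lemma isometry_near m n (V : 'M[C]_(m, n)) :
  V ^t* *m V = 1%:M -> fro_norm (V ^t* *m V - 1%:M) <= 0.
Proof. by move=> ->; rewrite subrr fro_norm0. Qed.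

Lemma fro_norm_isometry m n k (V : 'M[C]_(m, n)) (Y : 'M[C]_(n, k)) :
  V ^t* *m V = 1%:M -> fro_norm (V *m Y) = fro_norm Y.
Proof.
by move=> h; rewrite /fro_norm !fro_norm2E ip_mulmxl mulmxA h mul1mx.
Qed.

Lemma fro_norm_coisometry m n k (V : 'M[C]_(m, n)) (B : 'M[C]_(m, k)) :
  V ^t* *m V = 1%:M -> fro_norm (V ^t* *m B) <= fro_norm B.
Proof.
move=> h; rewrite -(@ler_pXn2r _ 2) ?nnegrE ?fro_norm_ge0 //.
rewrite !sqr_fro_norm.
by have := near_coisometry_sqr (isometry_near h) B; rewrite addr0 mul1r.
Qed.

Lemma sqr_fro_norm_isometry m n (V : 'M[C]_(m, n)) :
  V ^t* *m V = 1%:M -> fro_norm V ^+ 2 = n%:R.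
Proof.
move=> h; rewrite -[V]mulmx1 fro_norm_isometry // sqr_fro_norm.
rewrite /ip ctrmx1 mulmx1 mxtrace1.
by rewrite -[n%:R : C](rmorph_nat (real_complex R)).
Qed.

Lemma fro_norm_isometry1 m n (V : 'M[C]_(m, n)) :
  V ^t* *m V = 1%:M -> fro_norm V = Num.sqrt n%:R.
Proof.
by move=> /sqr_fro_norm_isometry <-; rewrite sqrtr_sqr ger0_norm ?fro_norm_ge0.
Qed.

(** [Y] orthonormalizes a basis of the row space, so [M = D Y] for some [D]. Having only [\rank M]
    rows, [Y] has Frobenius norm [sqrt (\rank M)], the source of such factors below. *)
Lemma row_space_coisometry m n (M : 'M[C]_(m, n)) :
  exists2 Y : 'M[C]_(\rank M, n), Y *m Y ^t* = 1%:M & M *m Y ^t* *m Y = M.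
Proof.
have rn : (\rank M <= n)%N := rank_leq_col M.
pose Y := schmidt (row_base M).
have Yu : Y *m Y ^t* = 1%:M by apply/unitarymxP; apply: schmidt_unitarymx.
exists Y => //.
have : (M <= Y)%MS.
  by rewrite -(eq_row_base M); apply: schmidt_sub.
case/submxP => D MD.
transitivity (D *m Y *m Y ^t* *m Y); first by congr (_ *m _ *m _).
by rewrite -(mulmxA D) Yu mulmx1.
Qed.

End Contraction.

(** * Singular values *)

Section KyFan.
Variable R : realType.

(** The total is largest when the weights [q] fill the top [k] places. Termwise comparison uses [c],
    the largest [w] outside them, and leaves the error [c (sum q - k) <= 0]. *)
Lemma ky_fan_weights p k (w q : 'I_p -> R) :
  (forall j, 0 <= w j) -> (forall i j : 'I_p, (i <= j)%N -> w j <= w i) ->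
  (forall j, 0 <= q j <= 1) -> \sum_j q j <= k%:R ->
  \sum_j w j * q j <= \sum_(j < p | (j < k)%N) w j.
Proof.
move=> w0 wmono q01 qk.
have [pk|kp] := leqP p k.
  rewrite [leRHS]big_mkcond; apply: ler_sum => j _.
  rewrite (leq_trans (ltn_ord j) pk) ler_piMr //.
  by have /andP[] := q01 j.
pose c := w (Ordinal kp).
have h j : w j * q j <= (if (j < k)%N then w j else 0) + c * (q j - (j < k)%:R).
  have /andP[q0 q1] := q01 j.
  case: ltnP => jk.
    have : c * (1 - q j) <= w j * (1 - q j).
      by rewrite ler_wpM2r ?subr_ge0 //; apply: wmono; apply: ltnW.
    rewrite /= mulr1n !mulrBr !mulr1 => ?; lra.
  by rewrite subr0 add0r ler_wpM2r //; apply: wmono.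
apply: le_trans (ler_sum _ (fun j _ => h j)) _.
rewrite big_split /= -big_mkcond /= -mulr_sumr gerDl sumrB.
have -> : \sum_(j < p) (j < k)%:R = k%:R :> R.
  rewrite -natr_sum; congr (_%:R).
  by rewrite -(big_mkcond (fun j : 'I_p => (j < k)%N) (fun=> 1%N)) /=
     (big_ord_narrow (ltnW kp)) sum_nat_const card_ord muln1.
by rewrite mulr_ge0_le0 ?w0 // subr_le0.
Qed.

End KyFan.

(** * Diagonal factors and the Gram matrix of a singular value decomposition *)

Section Diagonal.
Variable R : realType.
Local Notation C := R[i].

Lemma fro_norm_mul_diag m n (M : 'M[C]_(m, n)) (e : 'rV[C]_n) c :
  0 <= c -> (forall j, abs2 (e 0 j) <= c ^+ 2) ->
  fro_norm (M *m diag_mx e) <= c * fro_norm M.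
Proof.
move=> c0 ec; rewrite -(@ler_pXn2r _ 2) ?nnegrE ?mulr_ge0 ?fro_norm_ge0 //.
rewrite exprMn !sqr_sqrtr ?fro_norm2_ge0 // mulr_sumr; apply: ler_sum => i _.
rewrite mulr_sumr; apply: ler_sum => j _.
by rewrite mul_mx_diag mxE abs2M mulrC ler_wpM2r ?abs2_ge0.
Qed.

Lemma ip_sub_le m n (X Y : 'M[C]_(m, n)) :
  ip (X - Y) (X - Y) <= 2 * ip X X + 2 * ip Y Y.
Proof.
rewrite ipBl !ipBr (ipC Y X).
have := fro_norm2_ge0 (X + Y); rewrite fro_norm2E ipDl !ipDr (ipC Y X); lra.
Qed.

Lemma ip_mul_diag m n (M : 'M[C]_(m, n)) (e : 'rV[C]_n) :
  ip (M *m diag_mx e) (M *m diag_mx e) =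
  \sum_j abs2 (e 0 j) * \sum_i abs2 (M i j).
Proof.
rewrite -fro_norm2E /fro_norm2 /row_norm2 exchange_big; apply: eq_bigr => j _.
rewrite mulr_sumr; apply: eq_bigr => i _.
by rewrite mul_mx_diag mxE abs2M mulrC.
Qed.

(** Column [j] is the image of a basis vector under the adjoint of an isometry, which is a
    contraction. *)
Lemma coisometry_col m n (M : 'M[C]_(m, n)) j :
  M *m M ^t* = 1%:M -> \sum_i abs2 (M i j) <= 1.
Proof.
move=> MM.
have MM' : (M ^t*) ^t* *m M ^t* = 1%:M by rewrite trmxCK.
have /= := fro_norm_coisometry (delta_mx j (0 : 'I_1)) MM'.
rewrite trmxCK -colE -(@ler_pXn2r _ 2) ?nnegrE ?fro_norm_ge0 //.
rewrite !sqr_sqrtr ?fro_norm2_ge0 // => h.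
apply: le_trans (le_trans h _).
  by apply: ler_sum => i _; rewrite /row_norm2 big_ord1 mxE.
rewrite /fro_norm2 (bigD1 j) //= big1 => [|i ij];
  rewrite /row_norm2 big_ord1 mxE.
  by rewrite !eqxx addr0 -[_%:R]/(1%:C) abs2_real expr1n.
by rewrite (negbTE ij) /= -[_%:R]/(0%:C) abs2_real expr0n.
Qed.

Lemma diag_real_ctr n (e : 'rV[R]_n) :
  (diag_mx (map_mx (real_complex R) e)) ^t* =
  diag_mx (map_mx (real_complex R) e).
Proof.
rewrite tr_diag_mx map_diag_mx; congr diag_mx; apply/rowP => j.
rewrite !mxE; exact: conjc_real.
Qed.

Lemma svd_gram p (W : 'M[C]_p) (s : 'rV[R]_p) U : is_svd W s U ->
  W *m W ^t* = U *m diag_mx (map_mx (real_complex R) s) *m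
     diag_mx (map_mx (real_complex R) s) *m U ^t*.
Proof.
case=> _ _ _ [Z Zu ->].
rewrite !ctrmxM trmxCK diag_real_ctr !mulmxA.
by rewrite (mulmxKtV _ Zu).
Qed.

End Diagonal.

(** * Sampled singular vectors *)

Section SampledSingularVectors.
Variables (R : realType) (n p : nat).
Local Notation C := R[i].
Variables (A : 'M[C]_n) (S : 'M[C]_(p, n)) (W : 'M[C]_p).
Variables (s : 'rV[R]_p) (U : 'M[C]_p) (K : pred 'I_p) (g theta : R).
Hypotheses (sU : is_svd W s U) (g0 : 0 < g).
Hypothesis Kg : forall j, K j -> g <= s 0 j ^+ 2.
Hypothesis hF : fro_norm (S *m S ^t* - W *m W ^t*) <= theta.

Local Notation k := #|K|.
Let ev : 'I_k -> 'I_p := enum_val.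
Let V := approxV S s U K.
Let UK : 'M[C]_(p, k) := colsub ev U.
Let sK : 'rV[R]_k := \row_j s 0 (ev j).
Let DK := diag_mx (map_mx (real_complex R) sK).
Let DiK := diag_mx (map_mx (real_complex R) (\row_j (sK 0 j)^-1)).
Let F := S *m S ^t* - W *m W ^t*.

Let theta0 : 0 <= theta.
Proof. by apply: le_trans hF; apply: fro_norm_ge0. Qed.

Let sK_neq0 j : sK 0 j != 0.
Proof.
have := Kg (enum_valP j); rewrite mxE => h.
by apply: contraTneq h => ->; rewrite expr0n -ltNge.
Qed.

Let approxVE : V = S ^t* *m UK *m DiK.
Proof.
apply/matrixP => i j; rewrite mul_mx_diag !mxE fmorphV; congr (_ / _).
by apply: eq_bigr => l _; rewrite !mxE.
Qed.

Let UU : U ^t* *m U = 1%:M.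
Proof. by case: sU => _ _ /unitarymxP /mulmx1C. Qed.

Let UKUK : UK ^t* *m UK = 1%:M.
Proof.
apply/matrixP => i j; have /matrixP/(_ (ev i) (ev j)) := UU.
rewrite !mxE (inj_eq enum_val_inj) => <-.
by apply: eq_bigr => l _; rewrite !mxE.
Qed.

Let DiKD : DiK *m DK = 1%:M.
Proof.
apply/matrixP => i j; rewrite mul_diag_mx !mxE.
case: eqVneq => [->|_]; last by rewrite !mulr0n mulr0.
by rewrite !mulr1n -rmorphM mulVf //; have := sK_neq0 j; rewrite mxE.
Qed.

Let DKDi : DK *m DiK = 1%:M.
Proof. exact: mulmx1C. Qed.

Let WWUK : W *m W ^t* *m UK = UK *m DK *m DK.
Proof.
rewrite (svd_gram sU).
have -> : UK = U *m colsub ev 1%:M by rewrite mulmx_colsub mulmx1.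
rewrite -(mulmxA _ (U ^t*)) (mulmxA (U ^t*)) UU mul1mx -!(mulmxA U).
congr (U *m _); rewrite -[LHS]mulmxA; apply/matrixP => i j.
rewrite !mul_diag_mx !mul_mx_diag !mxE.
case: eqVneq => [->|_] /=; rewrite ?mulr0n ?mulr1n ?mulr0 ?mul0r //.
by rewrite mulr1 mul1r.
Qed.

(** The columns of [UK] are exact eigenvectors of [W W^H], hence eigenvectors of [S S^H] up to
    [F UK]. *)
Let SSUK : S *m S ^t* *m UK = UK *m DK *m DK + F *m UK.
Proof. by rewrite -WWUK -mulmxDl addrC subrK. Qed.

Let norm_mul_DiK m (M : 'M[C]_(m, k)) :
  fro_norm (M *m DiK) <= (Num.sqrt g)^-1 * fro_norm M.
Proof.
apply: fro_norm_mul_diag => [|j]; first by rewrite invr_ge0 sqrtr_ge0.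
rewrite !mxE abs2_real !exprVn sqr_sqrtr ?(ltW g0) // lef_pV2 ?posrE //.
  exact: Kg (enum_valP j).
by rewrite exprn_even_gt0 //=; have := sK_neq0 j; rewrite mxE.
Qed.

(** By [SSUK] the defect is [DiK UK^H F UK DiK]. Each [DiK] costs [1 / sqrt g] because the retained
    values satisfy [s_j^2 >= g], and [UK] costs nothing. *)
Lemma approxV_near_isometry : fro_norm (V ^t* *m V - 1%:M) <= theta / g.
Proof.
have -> : V ^t* *m V - 1%:M = DiK *m (UK ^t* *m F *m UK) *m DiK.
  rewrite approxVE !ctrmxM trmxCK diag_real_ctr.
  rewrite !mulmxA -(mulmxA _ S) -(mulmxA _ (S *m _)) SSUK mulmxDr mulmxDl.
  rewrite -!mulmxA DKDi mulmx1 (mulmxA (UK ^t*)) UKUK mul1mx DiKD.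
  by rewrite addrAC subrr add0r.
have sg : (Num.sqrt g)^-1 * (Num.sqrt g)^-1 = g^-1.
  by rewrite -invfM -expr2 sqr_sqrtr // ltW.
apply: le_trans (norm_mul_DiK _) _.
rewrite -fro_norm_adj ctrmxM diag_real_ctr.
apply: le_trans (ler_wpM2l _ (norm_mul_DiK _)) _.
  by rewrite invr_ge0 sqrtr_ge0.
rewrite mulrA sg mulrC ler_pM2r ?invr_gt0 // fro_norm_adj.
apply: le_trans hF; rewrite -/F -(mulmxA _ F).
apply: le_trans (fro_norm_coisometry _ UKUK) _.
rewrite -fro_norm_adj ctrmxM -[leRHS]fro_norm_adj.
exact: fro_norm_coisometry.
Qed.

Variable rk : nat.
Hypothesis Krk : forall j, K j -> (j < rk)%N.
Hypothesis nKg : forall j : 'I_p, (j < rk)%N -> ~~ K j -> s 0 j ^+ 2 <= g.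
Hypothesis rkS : (\rank S <= rk)%N.

Let card_K : (k <= rk)%N.
Proof.
have f_inj : injective (fun j : 'I_k => Ordinal (Krk (enum_valP j))).
  by move=> i j /(congr1 val) /= /val_inj/enum_val_inj.
by have := leq_card _ f_inj; rewrite !card_ord.
Qed.

(** Let the rows of [Y] be an orthonormal basis of the row space of [S^H]. Then [|S|^2] is the trace
    of [Y S S^H Y^H]; replacing [S S^H] by [W W^H] costs [<Y F, Y> <= sqrt rk * theta], and Ky Fan
    bounds the trace that remains. *)
Let gram_trace_bound : ip S S <=
  \sum_(j < p | (j < rk)%N) s 0 j ^+ 2 + Num.sqrt rk%:R * theta.
Proof.
have [Y YY SY] := row_space_coisometry (S ^t*).
have rkY : (\rank (S ^t*) <= rk)%N by rewrite mxrank_map mxrank_tr.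
have nY : fro_norm Y <= Num.sqrt rk%:R.
  have h := @fro_norm_isometry1 _ _ _ (Y ^t*); rewrite trmxCK in h.
  by rewrite -fro_norm_adj h // ler_wsqrtr // ler_nat.
have YS : Y ^t* *m Y *m S = S.
  have := congr1 (fun M => M ^t*) SY.
  by rewrite !ctrmxM !trmxCK mulmxA.
have YX : ip (Y *m (S *m S ^t*)) Y = ip S S.
  by rewrite mulmxA ip_mulmxr trmxCK ip_mulmxl mulmxA YS.
have -> : ip S S = ip (Y *m (W *m W ^t*)) Y + ip (Y *m F) Y.
  by rewrite -ipDl -mulmxDr -YX /F addrC subrK.
apply: lerD; last first.
  apply: le_trans (ler_ip _ _) _; rewrite mulrC; apply: ler_pM => //.
  - exact: fro_norm_ge0.
  - exact: fro_norm_ge0.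
  have YY' : (Y ^t*) ^t* *m Y ^t* = 1%:M by rewrite trmxCK.
  apply: le_trans hF; have := fro_norm_coisometry F YY'.
  by rewrite trmxCK.
(* The Ky Fan weights are the squared column norms of [Y U]. Its rows are orthonormal, so each
   weight is at most 1 and they add up to the number of rows, at most [rk]. *)
have YUYU : (Y *m U) *m (Y *m U) ^t* = 1%:M.
  rewrite ctrmxM mulmxA -(mulmxA Y) (mulmx1C UU) mulmx1 //.
rewrite (svd_gram sU) !mulmxA.
have -> : ip (Y *m U *m diag_mx (map_mx (real_complex R) s) *m
               diag_mx (map_mx (real_complex R) s) *m U ^t*) Y =
   ip (Y *m U *m diag_mx (map_mx (real_complex R) s))
      (Y *m U *m diag_mx (map_mx (real_complex R) s)).
  by rewrite !ip_mulmxr !trmxCK diag_real_ctr.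
rewrite ip_mul_diag.
under eq_bigr do rewrite mxE abs2_real.
have [s0 smono _ _] := sU.
apply: ky_fan_weights.
- by move=> j; apply: sqr_ge0.
- by move=> i j ij; rewrite ler_sqr ?nnegrE // smono.
- move=> j; rewrite coisometry_col // andbT.
  by apply: sumr_ge0 => i _; apply: abs2_ge0.
rewrite exchange_big /=.
have -> : \sum_i \sum_j abs2 ((Y *m U) i j) = fro_norm ((Y *m U) ^t*) ^+ 2.
  by rewrite fro_norm_adj sqr_sqrtr ?fro_norm2_ge0.
by rewrite sqr_fro_norm_isometry ?trmxCK // ler_nat.
Qed.

(** The converse estimate: the trace of [UK^H W W^H UK] is exactly the sum of the retained squares,
    and passing to [S S^H] costs [<F UK, UK>] with [|UK| <= sqrt rk]. *)
Let kept_trace_bound :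
  \sum_(j | K j) s 0 j ^+ 2 - Num.sqrt rk%:R * theta <=
  ip (UK ^t* *m S) (UK ^t* *m S).
Proof.
have -> : ip (UK ^t* *m S) (UK ^t* *m S) =
          ip (UK *m DK *m DK) UK + ip (F *m UK) UK.
  by rewrite -ipDl -SSUK -mulmxA ip_mulmxl -[RHS]ip_adj ctrmxM trmxCK.
have -> : ip (UK *m DK *m DK) UK = \sum_(j | K j) s 0 j ^+ 2.
  rewrite ip_mulmxr diag_real_ctr ip_mul_diag.
  transitivity (\sum_(j in K) s 0 j ^+ 2) => //.
  rewrite [RHS]big_enum_val; apply: eq_bigr => j _.
  rewrite !mxE abs2_real; suff -> : \sum_i abs2 (UK i j) = 1 by rewrite mulr1.
  have /matrixP/(_ j j) := UKUK; rewrite !mxE eqxx => /(congr1 (@complex.Re R)).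
  rewrite Re_sum /= => <-; apply: eq_bigr => i _.
  by rewrite abs2E !mxE mulrC.
rewrite lerD2l lerNl; apply: le_trans (ler_norm _) _.
rewrite normrN; apply: le_trans (ip_cauchy _ _) _; rewrite mulrC.
apply: ler_pM; rewrite ?fro_norm_ge0 //.
  by rewrite fro_norm_isometry1 // ler_wsqrtr // ler_nat.
apply: le_trans hF; rewrite -fro_norm_adj ctrmxM -[leRHS]fro_norm_adj.
exact: fro_norm_coisometry.
Qed.

(** By Pythagoras this is the difference of the two traces bounded above. What survives of the
    singular values is the discarded ones among the first [rk]: at most [rk] terms, each at most
    [g]. *)
Let projection_residual :
  ip (S - UK *m UK ^t* *m S) (S - UK *m UK ^t* *m S) <=
  2 * Num.sqrt rk%:R * theta + rk%:R * g.
Proof.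
have -> : ip (S - UK *m UK ^t* *m S) (S - UK *m UK ^t* *m S) =
          ip S S - ip (UK ^t* *m S) (UK ^t* *m S).
  rewrite -mulmxA ipBl !ipBr (ipC S (_ *m _)) ip_mulmxl.
  have -> : ip (UK *m (UK ^t* *m S)) (UK *m (UK ^t* *m S)) =
            ip (UK ^t* *m S) (UK ^t* *m S).
    by rewrite ip_mulmxl mulmxA UKUK mul1mx.
  ring.
have discarded : \sum_(j < p | (j < rk)%N) s 0 j ^+ 2 <=
    \sum_(j | K j) s 0 j ^+ 2 + rk%:R * g.
  rewrite (bigID K) /= (eq_bigl K) => [|j]; last first.
    by apply/andP/idP => [[]//|Kj]; split => //; apply: Krk.
  rewrite lerD2l.
  apply: (@le_trans _ _ (\sum_(j < p | (j < rk)%N && ~~ K j) g)).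
    by apply: ler_sum => j /andP[jk nK]; apply: nKg.
  rewrite sumr_const -[leLHS]mulr_natl ler_wpM2r ?(ltW g0) // ler_nat.
  have f_inj : injective (fun j : {j : 'I_p | (j < rk)%N && ~~ K j} =>
      Ordinal (andP (valP j)).1).
    by move=> i j /(congr1 val) /= /val_inj/val_inj.
  by have := leq_card _ f_inj; rewrite card_sig card_ord.
have := gram_trace_bound; have := kept_trace_bound; lra.
Qed.

Let near := approxV_near_isometry.
Local Notation delta := (theta / g).

(** [SSUK] and [DK V^H = UK^H S] give [S V V^H = UK UK^H S + F UK DiK V^H]. The first term leaves
    the projection residual; the second has squared norm at most [(1 + delta) theta^2 / g], and
    [theta^2 / g = delta theta]. *)
Lemma sample_residual :
  ip (S *m (1%:M - V *m V ^t*)) (S *m (1%:M - V *m V ^t*)) <=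
  2 * (2 * Num.sqrt rk%:R * theta + rk%:R * g) +
  2 * (1 + delta) * delta * theta.
Proof.
have VK : DK *m V ^t* = UK ^t* *m S.
  by rewrite approxVE !ctrmxM trmxCK diag_real_ctr !mulmxA DKDi mul1mx.
have SV : S *m (V *m V ^t*) = UK *m UK ^t* *m S + F *m UK *m DiK *m V ^t*.
  rewrite {1}approxVE !mulmxA SSUK -(mulmxA UK (UK ^t*)) -VK mulmxDl mulmxDl.
  by rewrite -!mulmxA (mulmxA DK DiK) DKDi mul1mx.
rewrite mulmxBr mulmx1 SV opprD addrA.
set X := S - _; set Y := F *m _ *m _ *m _.
suff hY : ip Y Y <= (1 + delta) * (delta * theta).
  apply: le_trans (ip_sub_le X Y) _.
  have hX : ip X X <= 2 * Num.sqrt rk%:R * theta + rk%:R * g.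
    exact: projection_residual.
  lra.
have -> : ip Y Y = ip (V *m (F *m UK *m DiK) ^t*) (V *m (F *m UK *m DiK) ^t*).
  have YV : Y ^t* = V *m (F *m UK *m DiK) ^t* by rewrite /Y [LHS]ctrmxM trmxCK.
  by rewrite -[LHS]ip_adj YV.
apply: le_trans (near_isometry_sqr near _) _.
rewrite ler_wpM2l ?addr_ge0 ?divr_ge0 // ?(ltW g0) //.
rewrite ip_adj -sqr_fro_norm.
apply: (@le_trans _ _ (((Num.sqrt g)^-1 * theta) ^+ 2)).
  rewrite ler_pXn2r ?nnegrE ?mulr_ge0 ?invr_ge0 ?sqrtr_ge0 ?fro_norm_ge0 //.
  apply: le_trans (norm_mul_DiK _) _.
  rewrite ler_wpM2l ?invr_ge0 ?sqrtr_ge0 //.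
  apply: le_trans hF; rewrite -fro_norm_adj ctrmxM -[leRHS]fro_norm_adj.
  exact: fro_norm_coisometry.
rewrite exprMn exprVn sqr_sqrtr ?(ltW g0) //.
by rewrite le_eqVlt; apply/orP; left; apply/eqP; ring.
Qed.

Hypothesis hA : A ^t* = A.
Hypothesis rkA : rk = \rank A.
Variable B : 'M[C]_(p, n).
Hypothesis SBA : S = B *m A.
Hypothesis hE : fro_norm (S ^t* *m S - A ^t* *m A) <= theta.

(** [|N A|^2 = |A N|^2] exceeds [|S N|^2] by [<E N, N>]. Since [S = B A], the projector [Q] onto the
    row space of [A] fixes [E], so this excess is [<E, N N Q>], at most [theta sqrt rk]: four such
    terms come from [sample_residual], this is the fifth. *)
Lemma projected_residual : delta <= 1 ->
  ip ((1%:M - V *m V ^t*) *m A) ((1%:M - V *m V ^t*) *m A) <=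
  5 * Num.sqrt rk%:R * theta + 2 * (rk%:R * g) +
  2 * (1 + delta) * delta * theta.
Proof.
move=> d1; set N := 1%:M - V *m V ^t*.
have hN : N ^t* = N by rewrite ctrmxB ctrmx1 ctrmxM trmxCK.
have [Y YY AY] := row_space_coisometry A.
pose Q := Y ^t* *m Y.
have hQ : Q ^t* = Q by rewrite ctrmxM trmxCK.
have AQ : A *m Q = A by rewrite mulmxA.
have QA : Q *m A = A by rewrite -{1}hA -hQ -ctrmxM AQ.
(* For [delta <= 1] the matrix [N] is a contraction, so only the norm of the rank [rk] projector [Q]
   counts. *)
have NQ : fro_norm (N *m (N *m Q)) <= Num.sqrt rk%:R.
  have Nle k (M : 'M[C]_(n, k)) : fro_norm (N *m M) <= fro_norm M.
    have := near_projector_compl_norm near M.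
    by rewrite max_l // mul1r.
  apply: le_trans (Nle _ _) _; apply: le_trans (Nle _ _) _.
  have YY' : (Y ^t*) ^t* *m Y ^t* = 1%:M by rewrite trmxCK.
  rewrite (fro_norm_isometry _ YY') -fro_norm_adj.
  by rewrite (fro_norm_isometry1 YY') rkA.
have h1 := sample_residual; rewrite -/N in h1.
set E := A ^t* *m A - S ^t* *m S.
have hEt : E ^t* = E by rewrite ctrmxB !ctrmxM !trmxCK.
have QS : Q *m S ^t* = S ^t* by rewrite SBA ctrmxM hA mulmxA QA.
have QE : Q *m E = E by rewrite /E mulmxBr !mulmxA hA QA QS.
have EN : ip (A *m N) (A *m N) = ip (S *m N) (S *m N) + ip (E *m N) N.
  by rewrite mulmxBl ipBl -!mulmxA !(ip_mulmxl (_ ^t*)) !trmxCK addrC subrK.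
have hE' : fro_norm E <= theta by rewrite -fro_normN opprB.
clearbody E N Q.
have -> : ip (N *m A) (N *m A) = ip (A *m N) (A *m N).
  by rewrite -[LHS]ip_adj [(N *m A) ^t*]ctrmxM hN hA.
have EQ : ip (E *m N) N = ip E (N *m (N *m Q)).
  rewrite -QE -mulmxA ip_mulmxl hQ ip_mulmxr hN QE.
  by rewrite -[RHS]ip_adj hEt !ctrmxM hQ hN.
have h2 : ip E (N *m (N *m Q)) <= theta * Num.sqrt rk%:R.
  by apply: le_trans (ler_ip _ _) _; apply: ler_pM; rewrite ?fro_norm_ge0.
rewrite EN EQ; lra.
Qed.

End SampledSingularVectors.

(** * Importance sampling *)

Section NormBounds.
Variable R : realType.
Local Notation C := R[i].

(** A supremum bounds its set only if the set is bounded above; here the Frobenius norm of [M] is an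
    upper bound. *)
Lemma ler_fro_spectral_norm m n (M : 'M[C]_(m, n)) (x : 'cV[C]_n) :
  fro_norm x <= 1 -> fro_norm (M *m x) <= spectral_norm M.
Proof.
move=> x1; apply: ub_le_sup; last by exists x.
exists (fro_norm M) => _ [y /= y1 <-].
apply: le_trans (fro_norm_mul _ _) _.
by rewrite ler_piMr // fro_norm_ge0.
Qed.

Lemma fro_norm2_cols m n (M : 'M[C]_(m, n)) :
  fro_norm2 M = \sum_j fro_norm2 (col j M).
Proof.
rewrite /fro_norm2 /row_norm2 exchange_big; apply: eq_bigr => j _.
by apply: eq_bigr => i _; rewrite big_ord1 mxE.
Qed.

Lemma fro_norm2_col_coisometry m n (Y : 'M[C]_(m, n)) j :
  Y *m Y ^t* = 1%:M -> fro_norm2 (col j (Y ^t*)) = 1.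
Proof.
move=> /matrixP/(_ j j); rewrite !mxE eqxx => /(congr1 (@complex.Re R)).
rewrite Re_sum /= => <-; apply: eq_bigr => i _.
by rewrite /row_norm2 big_ord1 abs2E !mxE (conjcK (Y j i)) mulrC.
Qed.

(** [M] and [M Y^H] have the same Frobenius norm, and [M Y^H] has [\rank M] columns, each the image
    of a unit vector. *)
Lemma fro_norm2_le_rank m n (M : 'M[C]_(m, n)) :
  spectral_norm M <= 1 -> fro_norm2 M <= (\rank M)%:R.
Proof.
move=> M1; have [Y YY MY] := row_space_coisometry M.
have -> : fro_norm2 M = fro_norm2 (M *m Y ^t*).
  by rewrite !fro_norm2E -{1}MY ip_mulmxr.
rewrite fro_norm2_cols -[leRHS]mul1r mulr_natr.
rewrite -[X in _ *+ X]card_ord -sumr_const.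
apply: ler_sum => j _; rewrite !colE -mulmxA -colE.
have c1 : fro_norm (col j (Y ^t*)) <= 1.
  by rewrite /fro_norm (fro_norm2_col_coisometry _ YY) sqrtr1.
rewrite fro_norm2E -sqr_fro_norm expr_le1 ?fro_norm_ge0 //.
exact: le_trans (ler_fro_spectral_norm M c1) M1.
Qed.

Lemma abs2_sum n (b : 'I_n -> C) :
  abs2 (\sum_k b k) <= n%:R * \sum_k abs2 (b k).
Proof.
have := abs2_sum_mul (fun=> 1) b.
rewrite (eq_bigr b) => [|k _]; last by rewrite mul1r.
rewrite sumr_const card_ord -[1 : C]/(1%:C) abs2_real expr1n.
by rewrite -[1 *+ n]/(n%:R).
Qed.

Lemma row_norm2_sum m n tau (A : 'I_tau -> 'M[C]_(m, n)) i :
  row_norm2 (\sum_l A l) i <= tau%:R * \sum_l row_norm2 (A l) i.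
Proof.
rewrite /row_norm2 [X in _ * X]exchange_big /= mulr_sumr; apply: ler_sum => j _.
by rewrite summxE; apply: abs2_sum.
Qed.

Lemma fro_norm2_sum m n tau (A : 'I_tau -> 'M[C]_(m, n)) :
  fro_norm2 (\sum_l A l) <= tau%:R * \sum_l fro_norm2 (A l).
Proof.
rewrite /fro_norm2 [X in _ * X]exchange_big /= mulr_sumr; apply: ler_sum => i _.
exact: row_norm2_sum.
Qed.

End NormBounds.

(** * Second moments of i.i.d. sample means and of sampled Gram matrices *)

Section MonteCarlo.
Variable R : realType.
Local Notation C := R[i].

(** After expanding the square, the cross terms vanish because [g] has mean zero, and each diagonal
    term contributes one second moment. *)
Lemma iid_variance (I : finType) (p : nat) (w g : I -> R) :
  \sum_i w i = 1 -> \sum_i w i * g i = 0 ->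
  \sum_(x : {ffun 'I_p -> I}) (\prod_s w (x s)) * (\sum_s g (x s)) ^+ 2 =
  p%:R * \sum_i w i * g i ^+ 2.
Proof.
move=> w1 wg0.
under eq_bigr => x _ do rewrite expr2 mulr_suml mulr_sumr.
rewrite exchange_big /=.
transitivity (\sum_(s < p) \sum_i w i * g i ^+ 2); last first.
  by rewrite sumr_const card_ord mulr_natl.
apply: eq_bigr => s _.
under eq_bigr => x _ do rewrite mulrA mulr_sumr.
rewrite exchange_big /= (bigD1 s) //= [X in _ + X]big1 ?addr0 => [|t ts].
  (* [F] puts the extra factor at coordinate [s] only, so the summand is a product over coordinates
     and the sum over all samples factors. *)
  pose F (u : 'I_p) i := w i * (if u == s then g i ^+ 2 else 1).
  transitivity (\sum_(x : {ffun 'I_p -> I}) \prod_u F u (x u)).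
    apply: eq_bigr => x _; rewrite big_split /= -mulrA; congr (_ * _).
    by rewrite (bigD1 s) //= eqxx big1 ?mulr1 ?expr2 // => u /negbTE ->.
  rewrite -bigA_distr_bigA (bigD1 s) //= /F eqxx [X in _ * X]big1 ?mulr1 //.
  by move=> u /negbTE ->; under eq_bigr do rewrite mulr1.
pose F (u : 'I_p) i := w i * (if (u == s) || (u == t) then g i else 1).
transitivity (\sum_(x : {ffun 'I_p -> I}) \prod_u F u (x u)).
  apply: eq_bigr => x _; rewrite big_split /= -mulrA; congr (_ * _).
  rewrite (bigD1 s) //= eqxx /= (bigD1 t) //= eqxx orbT big1 ?mulr1 // => u.
  by case/andP => /negbTE -> /negbTE ->.
rewrite -bigA_distr_bigA (bigD1 s) //= /F eqxx /=.
by rewrite wg0 mul0r.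
Qed.

(** Centre [f] and use that the variance is at most the second moment. *)
Lemma iid_mean_variance (I : finType) (p : nat) (w f : I -> R) :
  (0 < p)%N -> \sum_i w i = 1 ->
  \sum_(x : {ffun 'I_p -> I}) (\prod_s w (x s)) *
    (p%:R^-1 * (\sum_s f (x s)) - \sum_i w i * f i) ^+ 2 <=
  p%:R^-1 * \sum_i w i * f i ^+ 2.
Proof.
move=> p0 w1; set mu := \sum_i w i * f i.
have pn0 : p%:R != 0 :> R by rewrite pnatr_eq0 -lt0n.
pose g i := f i - mu.
have wg0 : \sum_i w i * g i = 0.
  under eq_bigr do rewrite mulrBr.
  by rewrite sumrB -mulr_suml w1 mul1r subrr.
have gf : \sum_i w i * g i ^+ 2 = \sum_i w i * f i ^+ 2 - mu ^+ 2.
  transitivity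
    (\sum_i (w i * f i ^+ 2 - (2 * mu * (w i * f i) - mu ^+ 2 * w i))).
    by apply: eq_bigr => i _; rewrite /g; ring.
  by rewrite sumrB sumrB -!mulr_sumr w1 -/mu; ring.
have -> : \sum_(x : {ffun 'I_p -> I}) (\prod_s w (x s)) *
    (p%:R^-1 * (\sum_s f (x s)) - mu) ^+ 2 =
    p%:R^-1 ^+ 2 * (p%:R * \sum_i w i * g i ^+ 2).
  rewrite -(iid_variance p w1 wg0) mulr_sumr; apply: eq_bigr => x _.
  rewrite [RHS]mulrCA -exprMn; congr (_ * _ ^+ 2).
  rewrite /g sumrB sumr_const card_ord mulrBr; congr (_ - _).
  by rewrite -[mu *+ p]mulr_natl mulKf.
rewrite gf mulrA expr2 mulfVK // ler_wpM2l ?invr_ge0 //.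
by rewrite gerBl sqr_ge0.
Qed.

Lemma abs2_Re_Im (z : C) : abs2 z = complex.Re z ^+ 2 + complex.Im z ^+ 2.
Proof. by case: z => a b; rewrite abs2E /=; ring. Qed.

Lemma Re_realM (x : R) (z : C) : complex.Re (x%:C * z) = x * complex.Re z.
Proof. by case: z => a b /=; ring. Qed.

Lemma Im_realM (x : R) (z : C) : complex.Im (x%:C * z) = x * complex.Im z.
Proof. by case: z => a b /=; ring. Qed.

Lemma ImD (x y : C) : complex.Im (x + y) = complex.Im x + complex.Im y.
Proof. by case: x => ? ?; case: y. Qed.

Lemma ImN (x : C) : complex.Im (- x) = - complex.Im x.
Proof. by case: x. Qed.

Lemma Im_sum (I : finType) (F : I -> C) :
  complex.Im (\sum_i F i) = \sum_i complex.Im (F i).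
Proof. exact: (big_morph _ ImD). Qed.

Lemma iid_mean_variance_complex (I : finType) (p : nat) (w : I -> R)
    (f : I -> C) :
  (0 < p)%N -> \sum_i w i = 1 ->
  \sum_(x : {ffun 'I_p -> I}) (\prod_s w (x s)) *
    abs2 ((p%:R^-1)%:C * (\sum_s f (x s)) - \sum_i (w i)%:C * f i) <=
  p%:R^-1 * \sum_i w i * abs2 (f i).
Proof.
move=> p0 w1.
have h1 := iid_mean_variance (fun i => complex.Re (f i)) p0 w1.
have h2 := iid_mean_variance (fun i => complex.Im (f i)) p0 w1.
have := lerD h1 h2; rewrite -big_split -mulrDr -big_split /=.
have -> : \sum_i (w i * complex.Re (f i) ^+ 2 + w i * complex.Im (f i) ^+ 2) =
          \sum_i w i * abs2 (f i).
  by apply: eq_bigr => i _; rewrite abs2_Re_Im mulrDr.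
apply: le_trans; rewrite le_eqVlt; apply/orP; left; apply/eqP.
apply: eq_bigr => x _; rewrite abs2_Re_Im mulrDr.
rewrite ReD ReN ImD ImN Re_realM Im_realM !Re_sum !Im_sum.
congr (_ * (_ - _) ^+ 2 + _ * (_ - _) ^+ 2); apply: eq_bigr => i _.
  by rewrite Re_realM.
by rewrite Im_realM.
Qed.

Lemma conjc_div_real (z : C) (x : R) : conjc (z / x%:C) = conjc z / x%:C.
Proof.
rewrite -fmorphV; case: z => a b; apply/eqP; rewrite eq_complex /=.
by apply/andP; split; apply/eqP; ring.
Qed.

(* The normalization makes the Gram matrix of the sample an unbiased estimator
   of the Gram matrix of N when the p rows x are i.i.d. of law w. *)
Definition row_sample m n p (N : 'M[C]_(m, n)) (w : 'I_m -> R)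
    (x : {ffun 'I_p -> 'I_m}) : 'M[C]_(p, n) :=
  \matrix_(t, k) (N (x t) k / (Num.sqrt (p%:R * w (x t)))%:C).

(** Entry [(a, b)] of the sampled Gram matrix is the mean of [p] copies of [f a b], whose
    expectation is that entry of [N^H N]. Summed over [a] and [b], row [i] contributes
    [|N_i|^4 / w_i <= kappa |N_i|^2] to the second moment. *)
Lemma row_sample_variance m n p (N : 'M[C]_(m, n)) (w : 'I_m -> R) (kappa : R) :
  (0 < p)%N -> (forall i, 0 <= w i) -> \sum_i w i = 1 -> 0 <= kappa ->
  (forall i, row_norm2 N i <= kappa * w i) ->
  \sum_(x : {ffun 'I_p -> 'I_m}) (\prod_s w (x s)) *
    fro_norm2 ((row_sample N w x) ^t* *m row_sample N w x - N ^t* *m N) <=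
  p%:R^-1 * (kappa * fro_norm2 N).
Proof.
move=> p0 w0 w1 k0 Nk.
have pR0 : 0 <= p%:R :> R by [].
have pn0 : p%:R != 0 :> R by rewrite pnatr_eq0 -lt0n.
(* Rows of weight zero vanish, so the convention [1 / 0 = 0] introduces no bias. *)
have N0 i k : w i = 0 -> N i k = 0.
  move=> wi0; apply: abs2_eq0; apply/eqP; rewrite eq_le abs2_ge0 andbT.
  have := Nk i; rewrite wi0 mulr0; apply: le_trans.
  by rewrite /row_norm2 (bigD1 k) //= lerDl sumr_ge0 // => j _; apply: abs2_ge0.
pose f a b i : C := (w i)^-1%:C * (conjc (N i a) * N i b).
have entry (x : {ffun 'I_p -> 'I_m}) a b :
    ((row_sample N w x) ^t* *m row_sample N w x - N ^t* *m N) a b =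
    (p%:R^-1)%:C * (\sum_s f a b (x s)) - \sum_i (w i)%:C * f a b i.
  rewrite !mxE mulr_sumr; congr (_ - _); apply: eq_bigr => i _; last first.
    rewrite !mxE /f mulrA -rmorphM.
    have [wi0|wi0] := eqVneq (w i) 0; first by rewrite (N0 i b wi0) !mulr0.
    by rewrite mulfV // mul1r.
  rewrite !mxE /f -[LHS]/(conjc _ * _) conjc_div_real.
  set q := Num.sqrt _.
  have -> : (p%:R^-1)%:C * ((w (x i))^-1%:C * (conjc (N (x i) a) * N (x i) b)) =
      (q ^+ 2)%:C^-1 * (conjc (N (x i) a) * N (x i) b).
    by rewrite mulrA -rmorphM -invfM -fmorphV sqr_sqrtr ?mulr_ge0 ?w0.
  by rewrite expr2 rmorphM invfM mulrACA [RHS]mulrC.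
have -> : \sum_(x : {ffun 'I_p -> 'I_m}) (\prod_s w (x s)) *
    fro_norm2 ((row_sample N w x) ^t* *m row_sample N w x - N ^t* *m N) =
    \sum_a \sum_b \sum_(x : {ffun 'I_p -> 'I_m}) (\prod_s w (x s)) *
      abs2 ((p%:R^-1)%:C * (\sum_s f a b (x s)) - \sum_i (w i)%:C * f a b i).
  under [RHS]eq_bigr do rewrite exchange_big /=.
  rewrite [RHS]exchange_big /=; apply: eq_bigr => x _.
  rewrite /fro_norm2 mulr_sumr; apply: eq_bigr => a _.
  by rewrite /row_norm2 mulr_sumr; apply: eq_bigr => b _; rewrite entry.
apply: (@le_trans _ _ (\sum_a \sum_b p%:R^-1 * \sum_i w i * abs2 (f a b i))).
  apply: ler_sum => a _; apply: ler_sum => b _.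
  exact: iid_mean_variance_complex.
under eq_bigr do rewrite -mulr_sumr.
rewrite -mulr_sumr ler_wpM2l ?invr_ge0 //.
under eq_bigr do rewrite exchange_big /=.
rewrite exchange_big /= mulr_sumr; apply: ler_sum => i _.
have -> : \sum_a \sum_b w i * abs2 (f a b i) = (w i)^-1 * (row_norm2 N i) ^+ 2.
  rewrite expr2 /row_norm2 mulr_suml mulr_sumr; apply: eq_bigr => a _.
  rewrite mulr_sumr mulr_sumr; apply: eq_bigr => b _.
  rewrite /f !abs2M abs2_conj abs2_real.
  have [->|wi0] := eqVneq (w i) 0; first by rewrite invr0 !mul0r.
  by field.
have [wi0|wi0] := eqVneq (w i) 0.
  by rewrite wi0 invr0 mul0r mulr_ge0 ?row_norm2_ge0.
have wpos : 0 < w i by rewrite lt_def wi0 w0.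
rewrite mulrC ler_pdivrMr // expr2 -mulrA mulrCA ler_wpM2l ?row_norm2_ge0 //.
Qed.

End MonteCarlo.

(** * The sampling procedure *)

Section SamplingProcedure.
Variables (R : realType) (tau n p : nat) (A_ : 'I_tau -> 'M[R[i]]_n).
Local Notation C := R[i].
Local Notation rowP := Defs.rowP.
Local Notation colP := Defs.colP.
Local Notation Phi := (\sum_l fro_norm2 (A_ l)).
Local Notation A := (\sum_l A_ l).
Hypotheses (p0 : (0 < p)%N) (Phi0 : 0 < Phi).

Let pn0 : p%:R != 0 :> R.
Proof. by rewrite pnatr_eq0 -lt0n. Qed.

Lemma rowP_ge0 i : 0 <= rowP A_ i.
Proof.
rewrite divr_ge0 // ?(ltW Phi0) // sumr_ge0 // => l _.
exact: row_norm2_ge0.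
Qed.

Lemma sum_rowP : \sum_i rowP A_ i = 1.
Proof. by rewrite -mulr_suml exchange_big /= mulfV // gt_eqF. Qed.

Lemma colQ_ge0 i j : 0 <= colQ A_ i j.
Proof.
by rewrite divr_ge0 // sumr_ge0 // => l _;
  [apply: abs2_ge0|apply: row_norm2_ge0].
Qed.

Lemma sum_colQ i : rowP A_ i != 0 -> \sum_j colQ A_ i j = 1.
Proof.
move=> Pi; rewrite -mulr_suml exchange_big /= mulfV //.
by apply: contra Pi => /eqP h; rewrite /rowP h mul0r.
Qed.

Lemma colP_ge0 (i : {ffun 'I_p -> 'I_n}) j : 0 <= colP A_ i j.
Proof.
by rewrite mulr_ge0 ?invr_ge0 // sumr_ge0 // => t _; apply: colQ_ge0.
Qed.

Lemma sum_colP (i : {ffun 'I_p -> 'I_n}) :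
  (forall t, rowP A_ (i t) != 0) -> \sum_j colP A_ i j = 1.
Proof.
move=> Pi; rewrite -mulr_sumr exchange_big /=.
rewrite (eq_bigr (fun=> 1)) => [|t _]; last exact: sum_colQ.
by rewrite sumr_const card_ord mulVf.
Qed.

Lemma sum_sampleS (i : {ffun 'I_p -> 'I_n}) :
  \sum_l sampleS A_ i l = row_sample A (rowP A_) i.
Proof.
apply/matrixP => t k; rewrite summxE !mxE summxE mulr_suml.
by apply: eq_bigr => l _; rewrite mxE.
Qed.

(** Sampling columns of [S] is sampling rows of [S^H], so one variance bound serves both steps. *)
Lemma sum_sampleW_ctr (i j : {ffun 'I_p -> 'I_n}) :
  (\sum_l sampleW A_ i j l) ^t* =
  row_sample ((\sum_l sampleS A_ i l) ^t*) (colP A_ i) j.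
Proof.
apply/matrixP => t k; rewrite !mxE.
have -> : (\sum_l sampleW A_ i j l) k t =
    (\sum_l sampleS A_ i l) k (j t) / (Num.sqrt (p%:R * colP A_ i (j t)))%:C.
  by rewrite !summxE mulr_suml; apply: eq_bigr => l _; rewrite mxE.
exact: conjc_div_real.
Qed.

(** Dividing by [rowP] trades the row energy for [Phi], which turns squared entries into [colQ].
    This gives both the density bound for the second step and the constant energy of [W]. *)
Lemma column_energy (i : {ffun 'I_p -> 'I_n}) j :
  \sum_l \sum_t abs2 (sampleS A_ i l t j) = Phi * colP A_ i j.
Proof.
rewrite exchange_big /colP /= mulrCA !mulr_sumr; apply: eq_bigr => t _.
have -> : \sum_l abs2 (sampleS A_ i l t j) =
    (\sum_l abs2 (A_ l (i t) j)) / (p%:R * rowP A_ (i t)).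
  rewrite mulr_suml; apply: eq_bigr => l _.
  by rewrite mxE abs2M abs2V abs2_real sqr_sqrtr // mulr_ge0 // rowP_ge0.
rewrite /colQ /rowP invfM invf_div; ring.
Qed.

(** By [column_energy] every sampled column carries energy [Phi / p], whichever index is drawn. *)
Lemma sum_fro_norm2_sampleW (i j : {ffun 'I_p -> 'I_n}) :
  (forall t, colP A_ i (j t) != 0) ->
  \sum_l fro_norm2 (sampleW A_ i j l) = Phi.
Proof.
move=> Pj.
transitivity (\sum_(t < p) Phi / p%:R); last first.
  by rewrite sumr_const card_ord -[LHS]mulr_natr mulfVK.
transitivity (\sum_t \sum_l \sum_s abs2 (sampleW A_ i j l s t)).
  rewrite [RHS]exchange_big /=; apply: eq_bigr => l _.
  by rewrite [RHS]exchange_big.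
apply: eq_bigr => t _.
have -> : Phi / p%:R = Phi * colP A_ i (j t) / (p%:R * colP A_ i (j t)).
  by rewrite invfM [p%:R^-1 * _]mulrC mulrA mulfK.
rewrite -column_energy mulr_suml; apply: eq_bigr => l _.
rewrite mulr_suml; apply: eq_bigr => s _.
by rewrite mxE abs2M abs2V abs2_real sqr_sqrtr // mulr_ge0 // colP_ge0.
Qed.

Let row_bound i : row_norm2 A i <= tau%:R * Phi * rowP A_ i.
Proof.
apply: le_trans (row_norm2_sum A_ i) _.
by rewrite -mulrA ler_wpM2l // [leRHS]mulrC /rowP mulfVK // gt_eqF.
Qed.

Lemma sampleS_variance :
  \sum_(i : {ffun 'I_p -> 'I_n}) (\prod_s rowP A_ (i s)) *
    (let S := \sum_l sampleS A_ i l in fro_norm2 (S ^t* *m S - A ^t* *m A)) <=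
  p%:R^-1 * (tau%:R * Phi) ^+ 2.
Proof.
have tP : 0 <= tau%:R * Phi by rewrite mulr_ge0 // ltW.
under eq_bigr do rewrite /= sum_sampleS.
apply: le_trans (row_sample_variance p0 rowP_ge0 sum_rowP tP row_bound) _.
by rewrite ler_wpM2l ?invr_ge0 // expr2 ler_wpM2l // fro_norm2_sum.
Qed.

Lemma sampleW_variance (i : {ffun 'I_p -> 'I_n}) :
  (forall t, rowP A_ (i t) != 0) ->
  \sum_(j : {ffun 'I_p -> 'I_n}) (\prod_s colP A_ i (j s)) *
    (let S := \sum_l sampleS A_ i l in let W := \sum_l sampleW A_ i j l in
     fro_norm2 (S *m S ^t* - W *m W ^t*)) <=
  p%:R^-1 * (tau%:R * Phi) ^+ 2.
Proof.
move=> Pi; set S := \sum_l sampleS A_ i l.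
have tP : 0 <= tau%:R * Phi by rewrite mulr_ge0 // ltW.
have cb j : row_norm2 (S ^t*) j <= tau%:R * Phi * colP A_ i j.
  rewrite -mulrA -column_energy mulr_sumr.
  under eq_bigr do rewrite mulr_sumr.
  rewrite exchange_big /=; apply: ler_sum => t _.
  rewrite !mxE abs2_conj /S summxE -mulr_sumr; exact: abs2_sum.
have h := row_sample_variance p0 (colP_ge0 i) (sum_colP Pi) tP cb.
have E j : fro_norm2 (S *m S ^t* -
      (\sum_l sampleW A_ i j l) *m (\sum_l sampleW A_ i j l) ^t*) =
    fro_norm2 ((row_sample (S ^t*) (colP A_ i) j) ^t* *m
      row_sample (S ^t*) (colP A_ i) j - (S ^t*) ^t* *m S ^t*).
  rewrite -sum_sampleW_ctr !trmxCK.
  by rewrite fro_norm2E -opprB ipNl ipC ipNl opprK -fro_norm2E.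
under eq_bigr do rewrite /= E.
apply: le_trans h _.
rewrite ler_wpM2l ?invr_ge0 // expr2 ler_wpM2l //.
apply: (@le_trans _ _ (\sum_j tau%:R * Phi * colP A_ i j)).
  by apply: ler_sum.
by rewrite -mulr_sumr sum_colP // mulr1.
Qed.

Let T := ({ffun 'I_p -> 'I_n} * {ffun 'I_p -> 'I_p} * {ffun 'I_p -> 'I_n})%type.

Definition run_law (c : T) : R :=
  (\prod_s rowP A_ (c.1.1 s)) *
  \prod_s (p%:R^-1 * colQ A_ (c.1.1 (c.1.2 s)) (c.2 s)).

(** The two errors are added so that a single use of Markov's inequality controls both. *)
Definition gram_error (c : T) : R :=
  let S := \sum_l sampleS A_ c.1.1 l in
  let W := \sum_l sampleW A_ c.1.1 c.2 l in
  fro_norm2 (S ^t* *m S - A ^t* *m A) + fro_norm2 (S *m S ^t* - W *m W ^t*).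

Lemma run_law_ge0 c : 0 <= run_law c.
Proof.
rewrite mulr_ge0 // prodr_ge0 // => s _; first exact: rowP_ge0.
by rewrite mulr_ge0 ?invr_ge0 // colQ_ge0.
Qed.

(** In a run of nonzero weight, the drawn [colQ] is a nonzero term of the average [colP]. *)
Lemma run_law_colP c : run_law c != 0 -> forall t, colP A_ c.1.1 (c.2 t) != 0.
Proof.
rewrite mulf_eq0 negb_or => /andP[_ /prodf_neq0 h] t.
have := h t isT; rewrite mulf_eq0 negb_or => /andP[_ Qn0].
rewrite mulf_neq0 ?invr_eq0 // psumr_neq0 => [|u _]; last exact: colQ_ge0.
apply/hasP; exists (c.1.2 t); first exact: mem_index_enum.
by rewrite /= lt_def Qn0 colQ_ge0.
Qed.

(** Summing out the uniform [t_s] averages [colQ] into [colP]: given the rows, the column indices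
    are i.i.d. of law [colP]. *)
Lemma sum_run_law_rows (F : {ffun 'I_p -> 'I_n} -> {ffun 'I_p -> 'I_n} -> R) :
  \sum_c run_law c * F c.1.1 c.2 =
  \sum_(i : {ffun 'I_p -> 'I_n}) (\prod_s rowP A_ (i s)) *
    \sum_(j : {ffun 'I_p -> 'I_n}) (\prod_s colP A_ i (j s)) * F i j.
Proof.
rewrite -(pair_big xpredT xpredT (fun c0 j => run_law (c0, j) * F c0.1 j)) /=.
rewrite -(pair_big xpredT xpredT
  (fun i t => \sum_j run_law (i, t, j) * F i j)) /=.
apply: eq_bigr => i _; rewrite exchange_big mulr_sumr /=.
apply: eq_bigr => j _; rewrite mulrA -mulr_suml; congr (_ * _).
rewrite /run_law /= -mulr_sumr; congr (_ * _).
rewrite -(bigA_distr_bigA (fun s t => p%:R^-1 * colQ A_ (i t) (j s))).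
by apply: eq_bigr => s _; rewrite -mulr_sumr.
Qed.

Lemma expected_gram_error :
  \sum_c run_law c * gram_error c <= 2 * (p%:R^-1 * (tau%:R * Phi) ^+ 2).
Proof.
set B := p%:R^-1 * _.
(* The error does not depend on the choices [t], so the identity fills that slot. *)
rewrite (sum_run_law_rows (fun i j => gram_error (i, [ffun t => t], j))).
apply: (@le_trans _ _ (\sum_(i : {ffun 'I_p -> 'I_n}) (\prod_s rowP A_ (i s)) *
    ((let S := \sum_l sampleS A_ i l in
      fro_norm2 (S ^t* *m S - A ^t* *m A)) + B))).
  apply: ler_sum => i _.
  have [->|Pi] := eqVneq (\prod_s rowP A_ (i s)) 0; first by rewrite !mul0r.
  have Pi' t : rowP A_ (i t) != 0.
    by have /prodf_neq0/(_ t isT) := Pi.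
  apply: ler_wpM2l; first by apply: prodr_ge0 => s _; apply: rowP_ge0.
  rewrite /gram_error /=; under eq_bigr do rewrite mulrDr.
  rewrite big_split /= -mulr_suml; apply: lerD; last exact: sampleW_variance.
  rewrite -(bigA_distr_bigA (fun (s : 'I_p) j => colP A_ i j)).
  by rewrite big1 ?mul1r // => s _; rewrite sum_colP.
under eq_bigr do rewrite mulrDr.
rewrite big_split /= -mulr_suml mulr_natl mulr2n; apply: lerD.
  exact: sampleS_variance.
rewrite -(bigA_distr_bigA (fun (s : 'I_p) i => rowP A_ i)).
by rewrite big1 ?mul1r // => s _; rewrite sum_rowP.
Qed.

Lemma gram_error_ge0 c : 0 <= gram_error c.
Proof. by rewrite addr_ge0 // fro_norm2_ge0. Qed.

(** The mean is at most [2 B], hence the level [20 B] is exceeded with probability at most 1/10. *)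
Lemma gram_error_markov : (0 < tau)%N ->
  \sum_(c | 20 * (p%:R^-1 * (tau%:R * Phi) ^+ 2) < gram_error c) run_law c <=
  10^-1.
Proof.
move=> tau0; have := expected_gram_error; set B := p%:R^-1 * _ => h.
have Bpos : 0 < B.
  by rewrite mulr_gt0 ?invr_gt0 ?exprn_gt0 ?mulr_gt0 ?ltr0n.
clearbody B.
rewrite -(@ler_pM2l _ (20 * B)) ?mulr_gt0 //.
rewrite (_ : _ * 10^-1 = 2 * B); last by field.
apply: le_trans h; rewrite mulr_sumr [leRHS]
  (bigID (fun c => 20 * B < gram_error c)) /=.
rewrite -[leLHS]addr0; apply: lerD.
  apply: ler_sum => c hc; rewrite mulrC ler_wpM2l ?run_law_ge0 //; exact: ltW.
by apply: sumr_ge0 => c _; rewrite mulr_ge0 ?run_law_ge0 ?gram_error_ge0.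
Qed.

End SamplingProcedure.

(** The event is a finite disjoint union of fibres of [f]. *)
Lemma probability_finite_law (R : realType) (d : measure_display)
  (Omega : measurableType d) (Pr : probability Omega R) (T : finType)
  (f : Omega -> T) (q : T -> R) (phi : pred T) :
  (forall c, measurable (f @^-1` [set c]) /\ Pr (f @^-1` [set c]) = (q c)%:E) ->
  Pr [set w | phi (f w)] = (\sum_(c | phi c) q c)%:E.
Proof.
move=> fq.
have -> : [set w | phi (f w)] =
    \bigcup_(c in [set` enum phi]) (f @^-1` [set c]).
  apply/seteqP; split=> w /=.
    by move=> phiw; exists (f w) => //=; rewrite mem_enum.
  by case=> c /=; rewrite mem_enum => phic ->.
rewrite measure_fin_bigcup //; first last.
- by move=> c _; have [] := fq c.
- exact: trivIset_preimage1.
rewrite -fsbig_seq ?enum_uniq // -sumEFin big_enum /=.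
by apply: eq_bigr => c _; have [] := fq c.
Qed.

(* Bookkeeping in terms of a = tau, b = r and T = eps / (300 r^2): then the
   threshold gamma is 3/100 T^2 / (a^2 b^2), the Gram error theta is at most
   108/10^4 Phi T^3 / (a^5 b^3), and delta = theta / (gamma Phi) is
   36/100 T / (a^3 b), while |A|_F, rank A and Phi are at most a b. *)
Section ErrorBudget.
Variable R : realFieldType.
Implicit Types a b T Phi m x delta : R.

(** If the maximum is 1, then [m <= a b <= T] suffices; otherwise [delta a b = 36/100 T / a^2]. *)
Lemma error_budget_large a b T m x delta :
  1 <= a -> 1 <= b -> a * b <= T -> delta = 36 / 100 * T / (a ^+ 3 * b) ->
  0 <= m -> m <= a * b -> x <= Num.max 1 delta * m -> x <= T.
Proof.
move=> a1 b1 abT -> m0 mab; move/le_trans; apply.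
have a0 : 0 < a by apply: lt_le_trans a1.
have b0 : 0 < b by apply: lt_le_trans b1.
have T0 : 0 <= T by apply: le_trans abT; rewrite mulr_ge0 // ltW.
rewrite maxr_pMl // ge_max mul1r (le_trans mab abT) /=.
apply: (@le_trans _ _ (36 / 100 * T / (a ^+ 3 * b) * (a * b))).
  by rewrite ler_wpM2l // divr_ge0 ?mulr_ge0 ?exprn_ge0 ?(ltW a0) ?(ltW b0).
rewrite (_ : _ * (a * b) = 36 / 100 * T / a ^+ 2); last first.
  by field; rewrite !gt_eqF.
rewrite ler_pdivrMr ?exprn_gt0 //.
have : T * 1 <= T * a ^+ 2 by rewrite ler_wpM2l // exprn_ege1.
lra.
Qed.

Lemma error_budget_small_delta a b T delta :
  1 <= a -> 1 <= b -> 0 < T -> T < a * b ->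
  delta = 36 / 100 * T / (a ^+ 3 * b) -> delta <= 1.
Proof.
move=> a1 b1 T0 Tab ->.
have a0 : 0 < a by apply: lt_le_trans a1.
have b0 : 0 < b by apply: lt_le_trans b1.
rewrite ler_pdivrMr ?mul1r ?mulr_gt0 ?exprn_gt0 //.
have : a * b <= a ^+ 3 * b by rewrite ler_wpM2r ?(ltW b0) // ler_eXnr.
lra.
Qed.

(** Here [c] and [c'] stand for [108/10^4] and [3/100], known only through rounded bounds. The three
    terms are at most 5/50, 2/25 and 4/50 of [T^2], together 26/100. *)
Lemma error_budget_small a b T Phi k s x theta g delta c c' :
  0 <= c -> c <= 1 / 50 -> 0 <= c' -> c' <= 1 / 25 ->
  1 <= a -> 1 <= b -> 0 < T -> T < a * b -> 0 <= Phi -> Phi <= a * b ->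
  delta = 36 / 100 * T / (a ^+ 3 * b) ->
  theta = Phi * (c * T ^+ 3 / (a ^+ 5 * b ^+ 3)) ->
  g = c' * T ^+ 2 / (a ^+ 2 * b ^+ 2) * Phi ->
  k <= a * b -> s <= a * b ->
  x ^+ 2 <= 5 * s * theta + 2 * (k * g) + 2 * (1 + delta) * delta * theta ->
  x <= T.
Proof.
move=> c0 c1 c0' c1' a1 b1 T0 Tab P0 Pab dE tE gE kab sab xle.
have a0 : 0 < a by apply: lt_le_trans a1.
have b0 : 0 < b by apply: lt_le_trans b1.
have ab0 : 0 < a * b by rewrite mulr_gt0.
(* [v] is the factor by which the bound on [a b theta] improves on [c T^2]; it is also [delta]
   without its constant. *)
pose v := T / (a ^+ 3 * b).
have v0 : 0 <= v.
  by rewrite divr_ge0 ?mulr_ge0 ?exprn_ge0 ?(ltW a0) ?(ltW b0) ?(ltW T0).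
have v1 : v <= 1.
  rewrite ler_pdivrMr ?mul1r ?mulr_gt0 ?exprn_gt0 //.
  apply: le_trans (ltW Tab) _; rewrite ler_wpM2r ?(ltW b0) //.
  by rewrite ler_eXnr.
have dv : delta = 36 / 100 * v by rewrite dE /v mulrA.
have T20 : 0 <= T ^+ 2 by apply: sqr_ge0.
have t0 : 0 <= theta.
  rewrite tE mulr_ge0 //.
  by rewrite divr_ge0 ?mulr_ge0 ?exprn_ge0 ?(ltW a0) ?(ltW b0) ?(ltW T0).
have g0 : 0 <= g.
  rewrite gE mulr_ge0 //.
  by rewrite divr_ge0 ?mulr_ge0 ?exprn_ge0 ?(ltW a0) ?(ltW b0) ?(ltW T0).
have abt : a * b * theta <= c * T ^+ 2.
  apply: (@le_trans _ _ (c * T ^+ 2 * v)); last first.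
    by rewrite ler_piMr // mulr_ge0.
  have -> : c * T ^+ 2 * v =
      a * b * (a * b * (c * T ^+ 3 / (a ^+ 5 * b ^+ 3))).
    by rewrite /v; field; rewrite !gt_eqF.
  rewrite tE !ler_wpM2l ?(ltW ab0) // ler_wpM2r //.
  by rewrite divr_ge0 ?mulr_ge0 ?exprn_ge0 ?(ltW a0) ?(ltW b0) ?(ltW T0).
have abg : a * b * g <= c' * T ^+ 2.
  have -> : c' * T ^+ 2 =
      a * b * (c' * T ^+ 2 / (a ^+ 2 * b ^+ 2) * (a * b)).
    by field; rewrite !gt_eqF.
  rewrite gE ler_wpM2l ?(ltW ab0) // ler_wpM2l //.
  by rewrite divr_ge0 ?mulr_ge0 ?exprn_ge0 ?(ltW a0) ?(ltW b0) ?(ltW T0).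
have cT : c * T ^+ 2 <= 1 / 50 * T ^+ 2 by rewrite ler_wpM2r.
have cT' : c' * T ^+ 2 <= 1 / 25 * T ^+ 2 by rewrite ler_wpM2r.
have st : s * theta <= a * b * theta by rewrite ler_wpM2r.
have kg : k * g <= a * b * g by rewrite ler_wpM2r.
have tab : theta <= a * b * theta.
  by rewrite ler_peMl // -[1]mulr1 ler_pM.
have d1 : delta <= 1 by lra.
have d0 : 0 <= delta by lra.
have dt : (1 + delta) * delta * theta <= 2 * theta.
  by rewrite ler_wpM2r // -[2]mulr1 ler_pM //; lra.
have x2 : x ^+ 2 <= T ^+ 2 by lra.
have [x0|x0] := leP x 0; first by apply: le_trans x0 (ltW T0).
by rewrite -(@ler_pXn2r _ 2) ?nnegrE ?(ltW T0) ?(ltW x0).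
Qed.

(** It suffices that [a + 1 <= 2 a^3 b] and [2 * 36/100 <= 1]. *)
Lemma error_budget_delta a b T delta :
  1 <= a -> 1 <= b -> 0 <= T -> delta = 36 / 100 * T / (a ^+ 3 * b) ->
  delta <= T / (a + 1).
Proof.
move=> a1 b1 T0 ->.
have a0 : 0 < a by apply: lt_le_trans a1.
have b0 : 0 < b by apply: lt_le_trans b1.
have ab : a <= a ^+ 3 * b.
  by rewrite -[leLHS]mulr1 ler_pM ?(ltW a0) ?ler_eXnr.
have a10 : 0 < a + 1 by rewrite addr_gt0.
rewrite ler_pdivrMr ?mulr_gt0 ?exprn_gt0 //.
rewrite [leRHS]mulrAC ler_pdivlMr //.
have : T * (a + 1) <= T * (2 * (a ^+ 3 * b)) by rewrite ler_wpM2l //; lra.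
have : 0 <= T * (a + 1) by rewrite mulr_ge0 // ltW.
lra.
Qed.

End ErrorBudget.

(** * Error bound for a typical run *)

Section GoodRun.
Variables (R : realType) (n tau r p : nat) (eps : R).
Variables (A_ : 'I_tau -> 'M[R[i]]_n).
Local Notation C := R[i].
Local Notation Phi := (\sum_l fro_norm2 (A_ l)).
Local Notation A := (\sum_l A_ l).

(** Sampling is left multiplication; this provides the factorization [S = B A]. *)
Lemma row_sample_mul m k q (N : 'M[C]_(m, k)) w (x : {ffun 'I_q -> 'I_m}) :
  row_sample N w x = row_sample 1%:M w x *m N.
Proof.
apply/matrixP => t j; rewrite !mxE (bigD1 (x t)) //= big1 => [|i ij].
  by rewrite !mxE eqxx addr0 mul1r mulrC.
by rewrite !mxE eq_sym (negbTE ij) !mul0r.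
Qed.

Hypotheses (eps0 : 0 < eps) (p0 : (0 < p)%N).
Hypotheses (tau0 : (0 < tau)%N) (r0 : (0 < r)%N).
Hypothesis Phi0 : 0 < Phi.
Hypothesis p_large :
  2 * 10 ^+ 20 * tau%:R ^+ 12 * r%:R ^+ 19 / eps ^+ 6 <= p%:R :> R.
Hypothesis hA : A ^t* = A.
Hypothesis A1 : forall l, spectral_norm (A_ l) <= 1.
Hypothesis rkA : forall l, (\rank (A_ l) <= r)%N.

Let a : R := tau%:R.
Let b : R := r%:R.
Let T := eps / (300 * b ^+ 2).
Let theta := Phi * (108 / 10 ^+ 4 * T ^+ 3 / (a ^+ 5 * b ^+ 3)).
Let g := 3 / 100 * T ^+ 2 / (a ^+ 2 * b ^+ 2) * Phi.
Let delta := 36 / 100 * T / (a ^+ 3 * b).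

Let a1 : 1 <= a. Proof. by rewrite ler1n. Qed.
Let b1 : 1 <= b. Proof. by rewrite ler1n. Qed.
Let a0 : 0 < a. Proof. exact: lt_le_trans a1. Qed.
Let b0 : 0 < b. Proof. exact: lt_le_trans b1. Qed.
Let T0 : 0 < T. Proof. by rewrite divr_gt0 ?mulr_gt0 ?exprn_gt0 ?ltr0n. Qed.

Let deltaE : theta / g = delta.
Proof. by rewrite /theta /g /delta; field; rewrite !gt_eqF. Qed.

Let gE : g = threshold tau r eps * Phi.
Proof.
by rewrite /g /threshold /T -/a -/b; congr (_ * _); field; rewrite !gt_eqF.
Qed.

Let g0 : 0 < g.
Proof.
have c0 : 0 < 3 / 100 :> R by rewrite divr_gt0 ?ltr0n.
have ab0 : 0 < a ^+ 2 * b ^+ 2 by rewrite mulr_gt0 ?exprn_gt0.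
have T20 : 0 < T ^+ 2 by rewrite exprn_gt0.
exact: mulr_gt0 (divr_gt0 (mulr_gt0 c0 T20) ab0) Phi0.
Qed.

Let Phi_le : Phi <= a * b.
Proof.
apply: (@le_trans _ _ (\sum_(l < tau) b)).
  apply: ler_sum => l _; apply: le_trans (fro_norm2_le_rank (A1 l)) _.
  by rewrite ler_nat.
by rewrite sumr_const card_ord mulr_natl.
Qed.

Let A_le : fro_norm A <= a * b.
Proof.
have ab0 : 0 <= a * b by rewrite mulr_ge0 // ltW.
rewrite -(@ler_pXn2r _ 2) ?nnegrE ?fro_norm_ge0 // /fro_norm.
rewrite sqr_sqrtr ?fro_norm2_ge0 //.
apply: le_trans (fro_norm2_sum A_) _; rewrite expr2.
apply: ler_pM => //; first by rewrite ltW.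
by rewrite ler_peMr // (ltW a0).
Qed.

Let rank_le : (\rank A)%:R <= a * b.
Proof.
rewrite /a /b -natrM ler_nat.
apply: (@leq_trans (\sum_(l < tau) \rank (A_ l))).
  elim/big_ind2: _ => [|x1 x2 y1 y2 h1 h2|//]; first by rewrite mxrank0.
  by apply: leq_trans (mxrank_add _ _) _; apply: leq_add.
rewrite -[X in (_ <= X * _)%N]card_ord -sum_nat_const.
by apply: leq_sum => l _.
Qed.

(** The constants are [20 / (2 * 10^20) = 10^-19] on the left and
    [(108/10^4)^2 / 300^6 = 16 * 10^-20] on the right; the left side has a further factor
    [1 / b]. *)
Let gram_bound : 20 * (p%:R^-1 * (tau%:R * Phi) ^+ 2) <= theta ^+ 2.
Proof.
have X0 : 0 < 2 * 10 ^+ 20 * a ^+ 12 * b ^+ 19 / eps ^+ 6.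
  by rewrite !mulr_gt0 ?invr_gt0 ?exprn_gt0.
apply: (@le_trans _ _ (20 * ((2 * 10 ^+ 20 * a ^+ 12 * b ^+ 19 / eps ^+ 6)^-1 *
                       (a * Phi) ^+ 2))).
  rewrite ler_wpM2l // ler_wpM2r ?sqr_ge0 //.
  by rewrite lef_pV2 ?posrE // (lt_le_trans X0).
have -> : 20 * ((2 * 10 ^+ 20 * a ^+ 12 * b ^+ 19 / eps ^+ 6)^-1 *
    (a * Phi) ^+ 2) =
    (10 ^+ 19)^-1 * (Phi ^+ 2 * eps ^+ 6 / (a ^+ 10 * b ^+ 18)) / b.
  by field; rewrite !gt_eqF.
have -> : theta ^+ 2 =
    16 * (10 ^+ 20)^-1 * (Phi ^+ 2 * eps ^+ 6 / (a ^+ 10 * b ^+ 18)).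
  by rewrite /theta /T; field; rewrite !gt_eqF.
set Z := Phi ^+ 2 * _ / _.
have Z0 : 0 <= Z.
  by rewrite !mulr_ge0 ?invr_ge0 ?mulr_ge0 ?exprn_ge0 ?(ltW a0) ?(ltW b0)
    ?(ltW eps0) ?(ltW Phi0).
rewrite ler_pdivrMr //.
have : Z * 1 <= Z * b by rewrite ler_wpM2l.
clearbody Z; rewrite !exprS expr0; lra.
Qed.

Lemma good_run_bound
    (c : {ffun 'I_p -> 'I_n} * {ffun 'I_p -> 'I_p} * {ffun 'I_p -> 'I_n}) :
  run_law A_ c != 0 ->
  gram_error A_ c <= 20 * (p%:R^-1 * (tau%:R * Phi) ^+ 2) ->
  let S := \sum_l sampleS A_ c.1.1 l in
  let Wl := sampleW A_ c.1.1 c.2 in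
  let W := \sum_l Wl l in
  forall (s : 'rV[R]_p) (U : 'M[C]_p), is_svd W s U ->
  let V := approxV S s U (kept (\rank A) (threshold tau r eps) Wl s) in
  fro_norm (V *m V ^t* *m A *m V *m V ^t* - A) <=
  eps / (300 * r%:R ^+ 2) * (2 + eps / (300 * r%:R ^+ 2 * (tau%:R + 1))).
Proof.
move=> c0 ce S Wl W s U sU; set K := kept _ _ _ _; pose V := approxV S s U K.
have TE : eps / (300 * r%:R ^+ 2 * (tau%:R + 1)) = T / (a + 1).
  by rewrite invfM mulrA.
rewrite TE; change (fro_norm (V *m V ^t* *m A *m V *m V ^t* - A) <=
  T * (2 + T / (a + 1))).
(* On runs of nonzero weight the cutoff is the deterministic number [g]. *)
have PhiW : \sum_l fro_norm2 (Wl l) = Phi.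
  apply: (sum_fro_norm2_sampleW p0 Phi0); exact: (run_law_colP p0 c0).
have Kg j : K j -> g <= s 0 j ^+ 2.
  by case/andP => _; rewrite PhiW -gE -leNgt.
have nKg (j : 'I_p) : (j < \rank A)%N -> ~~ K j -> s 0 j ^+ 2 <= g.
  move=> jr; rewrite -[K j]/((j < \rank A)%N &&
    ~~ (s 0 j ^+ 2 < threshold tau r eps * \sum_l fro_norm2 (Wl l))).
  by rewrite jr negbK PhiW -gE => /ltW.
have Krk j : K j -> (j < \rank A)%N by case/andP.
have c0' : 0 <= 108 / 10 ^+ 4 :> R by rewrite divr_ge0 ?exprn_ge0.
have th0 : 0 <= theta.
  have ab0 : 0 <= a ^+ 5 * b ^+ 3.
    by rewrite mulr_ge0 ?exprn_ge0 ?(ltW a0) ?(ltW b0).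
  have T30 : 0 <= T ^+ 3 by rewrite exprn_ge0 ?(ltW T0).
  exact: mulr_ge0 (ltW Phi0) (divr_ge0 (mulr_ge0 c0' T30) ab0).
have normle m k (M : 'M[C]_(m, k)) :
    fro_norm2 M <= theta ^+ 2 -> fro_norm M <= theta.
  move=> h; rewrite -(@ler_pXn2r _ 2) ?nnegrE ?fro_norm_ge0 // /fro_norm.
  by rewrite sqr_sqrtr ?fro_norm2_ge0.
have ge := le_trans ce gram_bound; rewrite /gram_error -/S -/W in ge.
have hE : fro_norm (S ^t* *m S - A ^t* *m A) <= theta.
  by apply: normle; apply: le_trans ge; rewrite lerDl fro_norm2_ge0.
have hF : fro_norm (S *m S ^t* - W *m W ^t*) <= theta.
  by apply: normle; apply: le_trans ge; rewrite lerDr fro_norm2_ge0.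
have SBA : S = row_sample 1%:M (Defs.rowP A_) c.1.1 *m A.
  by rewrite -row_sample_mul -sum_sampleS.
have rkS : (\rank S <= \rank A)%N by rewrite SBA mxrankM_maxr.
have near := approxV_near_isometry sU g0 Kg hF.
rewrite deltaE -/V in near.
apply: le_trans (near_projector_sandwich near hA) _.
have dT : delta <= T / (a + 1).
  by apply: (error_budget_delta a1 b1 (ltW T0)).
have d0 : 0 <= delta := near_isometry_ge0 near.
(* The factor [2 + delta] is at most [2 + T / (a + 1)]; it remains to bound the residual by [T]. *)
rewrite mulrC; apply: ler_pM; rewrite ?fro_norm_ge0 ?addr_ge0 //; last first.
  by rewrite lerD2l.
(* For [T >= a b] the size of [A] alone suffices; otherwise [delta <= 1] and the sampling estimate
   applies. *)
have [abT|Tab] := leP (a * b) T.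
  apply: (error_budget_large a1 b1 abT erefl (fro_norm_ge0 A) A_le).
  exact: (near_projector_compl_norm near).
have sq : Num.sqrt (\rank A)%:R <= a * b.
  apply: le_trans rank_le; case: (\rank A) => [|k]; first by rewrite sqrtr0.
  rewrite -[leRHS]ger0_norm // -sqrtr_sqr ler_wsqrtr // ler_eXnr //.
  by rewrite ler1n.
set X := fro_norm _.
have err : delta <= 1 -> X ^+ 2 <= 5 * Num.sqrt (\rank A)%:R * theta +
    2 * ((\rank A)%:R * g) + 2 * (1 + delta) * delta * theta.
  rewrite -deltaE => d1; rewrite sqr_fro_norm.
  exact: (projected_residual sU g0 Kg hF Krk nKg rkS hA erefl SBA hE d1).
have c1' : 108 / 10 ^+ 4 <= 1 / 50 :> R by rewrite !exprS expr0; lra.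
have c0'' : 0 <= 3 / 100 :> R by rewrite divr_ge0.
have c1'' : 3 / 100 <= 1 / 25 :> R by lra.
have d1 : delta <= 1.
  exact: (error_budget_small_delta a1 b1 T0 Tab erefl).
exact: (error_budget_small c0' c1' c0'' c1'' a1 b1 T0 Tab (ltW Phi0) Phi_le
  erefl erefl erefl rank_le sq (err d1)).
Qed.

End GoodRun.

Lemma num_samples_ge (R : realType) (tau r : nat) (eps : R) :
  0 < eps ->
  2 * 10 ^+ 20 * tau%:R ^+ 12 * r%:R ^+ 19 / eps ^+ 6 <=
  (num_samples tau r eps)%:R :> R.
Proof.
move=> eps0; apply: le_trans (ceil_ge _) _.
by rewrite -[leRHS]/((Posz (num_samples tau r eps))%:~R) ler_int abszE ler_norm.
Qed.

Unset Implicit Arguments.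

Theorem theorem3p2 (R : realType) (n tau r : nat) (eps : R)
  (A : 'M[R[i]]_n) (A_ : 'I_tau -> 'M[R[i]]_n)
  (d : measure_display) (Omega : measurableType d) (Pr : probability Omega R)
  (i : Omega -> {ffun 'I_(num_samples tau r eps) -> 'I_n})
  (t : Omega -> {ffun 'I_(num_samples tau r eps) -> 'I_(num_samples tau r eps)})
  (j : Omega -> {ffun 'I_(num_samples tau r eps) -> 'I_n}) :
  0 < eps ->
  A = \sum_l A_ l ->
  A \is hermsymmx ->
  (forall l, A_ l \is hermsymmx) ->
  (forall l, spectral_norm (A_ l) <= 1) ->
  (forall l, (\rank (A_ l) <= r)%N) ->
  sampling_run Pr A_ i t j ->
  (Pr [set w |
       let S := (\sum_l sampleS A_ (i w) l)%R in
       let Wl := sampleW A_ (i w) (j w) in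
       let W := (\sum_l Wl l)%R in
       forall (s : 'rV[R]_(num_samples tau r eps))
              (U : 'M[R[i]]_(num_samples tau r eps)),
         is_svd W s U ->
         let V :=
           approxV S s U (kept (\rank A) (threshold tau r eps) Wl s) in
         (fro_norm (V *m V ^t* *m A *m V *m V ^t* - A) <=
          eps / (300 * r%:R ^+ 2) *
          (2 + eps / (300 * r%:R ^+ 2 * (tau%:R + 1))))%R]
   >= (9 / 10)%:E)%E.
Proof.
move=> eps0 -> hermA _ A1 rkA run.
have hA : (\sum_l A_ l) ^t* = \sum_l A_ l.
  by have /is_hermitianmxP := hermA; rewrite expr0 scale1r => <-.
(* If [Phi = 0] then [A = 0], the error is zero and the event is the whole space. *)
have [Phi0|Phi0] := eqVneq (\sum_l fro_norm2 (A_ l)) 0.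
  have -> : \sum_l A_ l = 0.
    apply: big1 => l _; apply: fro_norm2_eq0; apply/eqP.
    move/eqP: Phi0; rewrite psumr_eq0 => [/allP/(_ l (mem_index_enum _))//|*].
    exact: fro_norm2_ge0.
  rewrite (_ : [set w | _] = setT); last first.
    apply/seteqP; split=> // w _ /= s U _.
    rewrite mulmx0 !mul0mx subrr fro_norm0.
    have e0 := ltW eps0.
    by rewrite mulr_ge0 ?addr_ge0 ?divr_ge0 ?mulr_ge0 ?addr_ge0 ?exprn_ge0.
  by rewrite probability_setT lee_fin; lra.
have {}Phi0 : 0 < \sum_l fro_norm2 (A_ l).
  by rewrite lt_def Phi0 sumr_ge0 // => l _; apply: fro_norm2_ge0.
have tau0 : (0 < tau)%N.
  case: (tau) A_ Phi0 {hermA A1 rkA run hA} => [B|//].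
  by rewrite big_ord0 ltxx.
have r0 : (0 < r)%N.
  rewrite lt0n; apply: contraTneq Phi0 => r0; rewrite -leNgt.
  apply: sumr_le0 => l _; apply: le_trans (fro_norm2_le_rank (A1 l)) _.
  by have := rkA l; rewrite r0 leqn0 => /eqP ->.
have p_large := num_samples_ge tau r eps0.
have p0 : (0 < num_samples tau r eps)%N.
  rewrite -(ltr0n R); apply: lt_le_trans p_large.
  by rewrite !mulr_gt0 ?invr_gt0 ?exprn_gt0 ?ltr0n.
pose run_type := ({ffun 'I_(num_samples tau r eps) -> 'I_n} *
    {ffun 'I_(num_samples tau r eps) -> 'I_(num_samples tau r eps)} *
    {ffun 'I_(num_samples tau r eps) -> 'I_n})%type.
pose phi (c : run_type) :=
  let S := \sum_l sampleS A_ c.1.1 l in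
  let Wl := sampleW A_ c.1.1 c.2 in
  let W := \sum_l Wl l in
  forall (s : 'rV[R]_(num_samples tau r eps))
         (U : 'M[R[i]]_(num_samples tau r eps)),
    is_svd W s U ->
    let V := approxV S s U
      (kept (\rank (\sum_l A_ l)%R) (threshold tau r eps) Wl s) in
    (fro_norm (V *m V ^t* *m (\sum_l A_ l) *m V *m V ^t* - \sum_l A_ l) <=
     eps / (300 * r%:R ^+ 2) *
     (2 + eps / (300 * r%:R ^+ 2 * (tau%:R + 1))))%R.
have law (c : run_type) :
    measurable ((fun w => (i w, t w, j w)) @^-1` [set c]) /\
    Pr ((fun w => (i w, t w, j w)) @^-1` [set c]) = (run_law A_ c)%:E.
  case: c => [[i0 t0] j0]; have := run i0 t0 j0.
  rewrite (_ : [set w | _] =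
    (fun w => (i w, t w, j w)) @^-1` [set (i0, t0, j0)]) //.
  by apply/seteqP; split=> w /= => [[-> -> ->]|[-> -> ->]].
(* The total mass is the probability of the whole space under the law of the run. *)
have total : \sum_(c : run_type) run_law A_ c = 1.
  have := probability_finite_law predT law.
  rewrite (_ : [set w | _] = setT); last by apply/seteqP; split.
  by rewrite probability_setT => -[/esym e]; exact: e.
rewrite (_ : [set w | _] = [set w | `[<phi (i w, t w, j w)>]]); last first.
  by apply/seteqP; split=> w; [move=> h; exact/asboolP | move/asboolP].
rewrite (probability_finite_law (fun c => `[<phi c>]) law) lee_fin.
(* Apart from runs of weight zero, every failing run exceeds the Markov level. *)
have bad : \sum_(c : run_type | ~~ `[<phi c>]) run_law A_ c <= 10^-1.
  apply: le_trans (gram_error_markov p0 Phi0 tau0).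
  rewrite big_mkcond [leRHS]big_mkcond /=; apply: ler_sum => c _.
  have [->|c0] := eqVneq (run_law A_ c) 0; first by rewrite !if_same.
  case: ltP => [_|cle]; first by case: ifP => // _; apply: run_law_ge0.
  rewrite ifF //; apply/negbTE; rewrite negbK; apply/asboolP => S Wl W s U sU.
  exact: (good_run_bound eps0 p0 tau0 r0 Phi0 p_large hA A1 rkA c0 cle sU).
move: total; rewrite (bigID (fun c => `[<phi c>])) /=.
lra.
Qed.
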